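(* Let $X$ and $Y$ be smooth manifolds of dimensions $n$ and $m$, with (complexified) linear connections given in local coordinates $(x^1,\dots,x^n)$ on $X$ and $(y^1,\dots,y^m)$ on $Y$ by Christoffel symbols $\Gamma^i{}_{jk}$ and $\Xi^q{}_{pr}$ respectively. Let $\gamma:Y\to X$ be a smooth map, and let $\tilde\gamma:C^\infty(X)\to C^\infty(Y)$, $\tilde\gamma(f)=f\circ\gamma$, $\gamma^i=\tilde\gamma(x^i)$. Let $M=C^\infty(Y)_{\tilde\gamma}$ be the $C^\infty(Y)$-$C^\infty(X)$-bimodule which is $C^\infty(Y)$ as a left module and has right action $k\triangleleft f=k\,\tilde\gamma(f)$. Give $M$ the left connection $$\mathrm{d}:C^\infty(Y)\to\Omega^1(Y)\cong\Omega^1(Y)\otimes_{C^\infty(Y)}C^\infty(Y).$$ Then this is a left $C^\infty(Y)$-$C^\infty(X)$-bimodule connection, with $$\sigma(k\otimes\mathrm{d}f)=\mathrm{d}(k\,\tilde\gamma(f))-\mathrm{d}(k)\,\tilde\gamma(f)=k\,\mathrm{d}(\tilde\gamma(f))\in\Omega^1(Y)=\Omega^1(Y)\otimes_{C^\infty(Y)}C^\infty(Y)$$ for $k\in M$ and $f\in C^\infty(X)$; in particular $\sigma(k\otimes\mathrm{d}x^i)=k\,\mathrm{d}\gamma^i$. Moreover, in local coordinates (with summation over repeated indices), $$D(\sigma)(1\otimes\mathrm{d}x^i)=\Big(\frac{\partial^2\gamma^i}{\partial y^r\partial y^p}-\frac{\partial\gamma^i}{\partial y^q}\,\Xi^q{}_{pr}+(\Gamma^i{}_{jk}\circ\gamma)\,\frac{\partial\gamma^j}{\partial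 y^p}\frac{\partial\gamma^k}{\partial y^r}\Big)\,\mathrm{d}y^p\otimes\mathrm{d}y^r .$$
   Context: Functions and 1-forms are smooth and complex valued; $\Omega^1(X)$ denotes the usual 1-forms on $X$. The connections on 1-forms are $\nabla(\mathrm{d}x^i)=-\Gamma^i{}_{jk}\,\mathrm{d}x^j\otimes\mathrm{d}x^k$ on $\Omega^1(X)$ and $\nabla(\mathrm{d}y^q)=-\Xi^q{}_{pr}\,\mathrm{d}y^p\otimes\mathrm{d}y^r$ on $\Omega^1(Y)$ (first tensor factor is the direction of differentiation), extended by the left Leibniz rule; they are bimodule connections with $\sigma$ the flip $\xi\otimes\eta\mapsto\eta\otimes\xi$. A left $B$-$A$-bimodule connection on a $B$-$A$-bimodule $M$ (where $A,B$ have calculi $\Omega^1_A,\Omega^1_B$) is a pair $(\nabla_M,\sigma_M)$ with $\nabla_M:M\to\Omega^1_B\otimes_B M$ linear satisfying $\nabla_M(b.m)=\mathrm{d}b\otimes m+b.\nabla_M(m)$, and $\sigma_M:M\otimes_A\Omega^1_A\to\Omega^1_B\otimes_B M$ a $B$-$A$-bimodule map with $\nabla_M(m.a)=\nabla_M(m).a+\sigma_M(m\otimes\mathrm{d}a)$. Given a left $C$-$B$-bimodule connection on $Q$ and a left $B$-$A$-bimodule connection on $M$, the tensor product connection on $Q\otimes_B M$ is $\nabla_{Q\otimes M}(q\otimes m)=\nabla_Q q\otimes m+(\sigma_Q\otimes\mathrm{id})(q\otimes\nabla_M m)$, with $\sigma_{Q\otimes M}=(\sigma_Q\otimes\mathrm{id})(\mathrm{id}\otimes\sigma_M)$.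 For a left module map $\theta:P\to N$ between bimodules with left connections, $D(\theta)=\nabla_N\theta-(\mathrm{id}\otimes\theta)\nabla_P$. Here $D(\sigma)=\nabla_{\Omega^1(Y)\otimes M}\,\sigma-(\mathrm{id}\otimes\sigma)\,\nabla_{M\otimes\Omega^1(X)}$ is a map from $M\otimes_{C^\infty(X)}\Omega^1(X)$ to $\Omega^1(Y)\otimes_{C^\infty(Y)}\Omega^1(Y)\otimes_{C^\infty(Y)}M\cong\Omega^1(Y)\otimes_{C^\infty(Y)}\Omega^1(Y)$. The coordinate formulas are understood over coordinate charts $V\subset Y$, $U\subset X$ with $\gamma(V)\subset U$. *)

(* Defs.v *)
From HB Require Import structures.
From mathcomp Require Import all_boot all_order all_algebra.
From mathcomp Require Import generic_quotient.
From mathcomp Require Import complex.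
From mathcomp Require Import all_classical all_reals all_analysis.

Set Implicit Arguments.
Unset Strict Implicit.
Unset Printing Implicit Defensive.

Import Order.TTheory GRing.Theory Num.Theory.
Import numFieldNormedType.Exports.

Local Open Scope quotient_scope.
Local Open Scope classical_set_scope.
Local Open Scope ring_scope.

Record bimodule (B A : pzRingType) := Bimodule {
  bimodule_left :> lmodType B;
  ract : bimodule_left -> A -> bimodule_left;
  ractDl : forall x y a, ract (x + y) a = ract x a + ract y a;
  ractDr : forall x a b, ract x (a + b) = ract x a + ract x b;
  ract1 : forall x, ract x 1 = x;
  ractM : forall x a b, ract x (a * b) = ract (ract x a) b;
  scaler_ract : forall b x a, b *: ract x a = ract (b *: x) a }.

Arguments ract {B A b} _ _ : rename.

Record bimodule_map (B A : pzRingType) (M N : bimodule B A) := BimoduleMap {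
  bimodule_map_fun :> M -> N;
  bimodule_mapD : forall x y,
    bimodule_map_fun (x + y) = bimodule_map_fun x + bimodule_map_fun y;
  bimodule_mapZ : forall b x,
    bimodule_map_fun (b *: x) = b *: bimodule_map_fun x;
  bimodule_mapR : forall x a,
    bimodule_map_fun (ract x a) = ract (bimodule_map_fun x) a }.

Section RActTheory.
Variables (B A : pzRingType) (M : bimodule B A).
Implicit Types (x : M) (a : A).

Lemma ract0l a : ract (0 : M) a = 0.
Proof. by apply: (addrI (ract (0 : M) a)); rewrite -ractDl !addr0. Qed.

Lemma ract0r x : ract x (0 : A) = 0.
Proof. by apply: (addrI (ract x (0 : A))); rewrite -ractDr !addr0. Qed.

Lemma ractNl x a : ract (- x) a = - ract x a.
Proof. by apply: (addrI (ract x a)); rewrite -ractDl !subrr ract0l. Qed.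

End RActTheory.

(* The tensor product of bimodules: finite formal sums of pairs modulo the    *)
(* congruence generated by biadditivity and (q b, m) ~ (q, b m).              *)
Section Tensor.
Variables (C B A : pzRingType) (Q : bimodule C B) (M : bimodule B A).

Inductive tensor_rel : seq (Q * M) -> seq (Q * M) -> Prop :=
| tensor_rel_refl s : tensor_rel s s
| tensor_rel_sym s t : tensor_rel s t -> tensor_rel t s
| tensor_rel_trans s t u : tensor_rel s t -> tensor_rel t u -> tensor_rel s u
| tensor_rel_cat s s' t t' :
    tensor_rel s s' -> tensor_rel t t' -> tensor_rel (s ++ t) (s' ++ t')
| tensor_rel_catC s t : tensor_rel (s ++ t) (t ++ s)
| tensor_rel_0 m : tensor_rel [:: (0, m)] [::]
| tensor_rel_addl q q' m :
    tensor_rel [:: (q + q', m)] [:: (q, m); (q', m)]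
| tensor_rel_addr q m m' :
    tensor_rel [:: (q, m + m')] [:: (q, m); (q, m')]
| tensor_rel_bal q b m : tensor_rel [:: (ract q b, m)] [:: (q, b *: m)].

Let tensor_eq : rel (seq (Q * M)) := fun s t => `[< tensor_rel s t >].

Fact tensor_eq_equiv : equiv_class_of tensor_eq.
Proof.
split=> [s|s t|t s u].
- exact/asboolP/tensor_rel_refl.
- by apply/asboolP/asboolP => /tensor_rel_sym.
- by move=> /asboolP st /asboolP tu; apply/asboolP/(tensor_rel_trans st tu).
Qed.

Canonical tensor_equiv := EquivRelPack tensor_eq_equiv.

Definition tensor_type := {eq_quot tensor_equiv}%qT.

HB.instance Definition _ := Choice.on tensor_type.
HB.instance Definition _ := EqQuotient.on tensor_type.

Definition tensor_pure (q : Q) (m : M) : tensor_type := \pi_tensor_type [:: (q, m)].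

Lemma tens_piP s t : tensor_rel s t -> \pi_tensor_type s = \pi_tensor_type t.
Proof. by move=> /asboolT st; apply/(@eqquotP _ tensor_eq tensor_type). Qed.

Lemma tensor_reprP s : tensor_rel (repr (\pi_tensor_type s)) s.
Proof. by apply/asboolP/(@eqquotP _ tensor_eq tensor_type); rewrite reprK. Qed.

Definition tensor_add (x y : tensor_type) : tensor_type :=
  \pi_tensor_type (repr x ++ repr y).
Definition tensor_zero : tensor_type := \pi_tensor_type [::].
Definition tensor_map_repr (f : Q -> Q) (g : M -> M) (x : tensor_type) :=
  \pi_tensor_type [seq (f p.1, g p.2) | p <- repr x].
Definition tensor_opp := tensor_map_repr -%R id.
Definition tensor_scale c := tensor_map_repr ( *:%R c) id.
Definition tensor_ract x a := tensor_map_repr id (ract^~ a) x.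

Lemma tensor_addE s t :
  tensor_add (\pi s) (\pi t) = \pi_tensor_type (s ++ t).
Proof. by apply: tens_piP; apply: tensor_rel_cat; apply: tensor_reprP. Qed.

Lemma tensor_map_reprE (f : Q -> Q) (g : M -> M) s :
  {morph f : x y / x + y} -> {morph g : x y / x + y} ->
  (forall q b, f (ract q b) = ract (f q) b) ->
  (forall b m, g (b *: m) = b *: g m) ->
  tensor_map_repr f g (\pi s) = \pi_tensor_type [seq (f p.1, g p.2) | p <- s].
Proof.
move=> fD gD fR gZ; apply: tens_piP.
have f0 : f 0 = 0 by apply: (addrI (f 0)); rewrite -fD !addr0.
move: (tensor_reprP s); move: (repr _) => r.
elim=> {r s} [s|s t _ ih|s t u _ ih1 _ ih2|s s' t t' _ ih1 _ ih2|s t|m|q q' m|q m m'|q b m] /=.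
- exact: tensor_rel_refl.
- exact: tensor_rel_sym.
- exact: tensor_rel_trans ih1 ih2.
- by rewrite !map_cat; exact: tensor_rel_cat.
- by rewrite !map_cat; exact: tensor_rel_catC.
- by rewrite f0; exact: tensor_rel_0.
- by rewrite fD; exact: tensor_rel_addl.
- by rewrite gD; exact: tensor_rel_addr.
- by rewrite fR gZ; exact: tensor_rel_bal.
Qed.

Lemma tensor_oppE s :
  tensor_opp (\pi s) = \pi_tensor_type [seq (- p.1, p.2) | p <- s].
Proof. by rewrite /tensor_opp tensor_map_reprE// => [x y|q b]; rewrite ?opprD ?ractNl. Qed.

Lemma tensor_scaleE c s :
  tensor_scale c (\pi s) = \pi_tensor_type [seq (c *: p.1, p.2) | p <- s].
Proof.
by rewrite /tensor_scale tensor_map_reprE// => [x y|q b]; rewrite ?scalerDr ?scaler_ract.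
Qed.

Lemma tensor_ractE s a :
  tensor_ract (\pi s) a = \pi_tensor_type [seq (p.1, ract p.2 a) | p <- s].
Proof.
by rewrite /tensor_ract tensor_map_reprE// => [x y|b m];
  rewrite ?ractDl ?scaler_ract.
Qed.

Lemma tensor_ind (P : tensor_type -> Prop) :
  (forall s, P (\pi s)) -> forall x, P x.
Proof. by move=> Ps x; rewrite -[x]reprK. Qed.

Fact tensor_addA : associative tensor_add.
Proof.
by elim/tensor_ind=> s; elim/tensor_ind=> t; elim/tensor_ind=> u;
  rewrite !tensor_addE catA.
Qed.

Fact tensor_addC : commutative tensor_add.
Proof.
elim/tensor_ind=> s; elim/tensor_ind=> t; rewrite !tensor_addE.
exact/tens_piP/tensor_rel_catC.
Qed.

Fact tensor_add0 : left_id tensor_zero tensor_add.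
Proof. by elim/tensor_ind=> s; rewrite tensor_addE. Qed.

Fact tensor_addN : left_inverse tensor_zero tensor_opp tensor_add.
Proof.
elim/tensor_ind; elim=> [|[q m] s ih].
  by rewrite tensor_oppE tensor_addE.
have cons p t : \pi_tensor_type (p :: t) = tensor_add (\pi [:: p]) (\pi t).
  by rewrite tensor_addE.
have qm : tensor_add (\pi [:: (- q, m)]) (\pi [:: (q, m)]) = tensor_zero.
  rewrite tensor_addE; apply: tens_piP.
  apply: tensor_rel_trans (tensor_rel_sym (tensor_rel_addl _ _ _)) _.
  by rewrite addNr; exact: tensor_rel_0.
move: ih; rewrite !tensor_oppE /= (cons (- q, m)) (cons (q, m)) => ih.
rewrite -tensor_addA (tensor_addA (\pi _) (\pi [:: (q, m)])).
rewrite [X in tensor_add _ (tensor_add X _)]tensor_addC -tensor_addA.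
by rewrite ih tensor_addA qm tensor_add0.
Qed.

HB.instance Definition _ := GRing.isZmodule.Build tensor_type
  tensor_addA tensor_addC tensor_add0 tensor_addN.

Lemma tensor_piD s t :
  \pi_tensor_type (s ++ t) = \pi_tensor_type s + \pi_tensor_type t.
Proof. by rewrite [RHS]tensor_addE. Qed.

Lemma tensor_piE s : \pi_tensor_type s = \sum_(p <- s) tensor_pure p.1 p.2.
Proof.
elim: s => [|[q m] s ih]; first by rewrite big_nil.
by rewrite big_cons -ih -tensor_piD.
Qed.

Lemma tensor_pureDl q q' m : tensor_pure (q + q') m = tensor_pure q m + tensor_pure q' m.
Proof. by rewrite -tensor_piD; exact/tens_piP/tensor_rel_addl. Qed.

Lemma tensor_pureDr q m m' : tensor_pure q (m + m') = tensor_pure q m + tensor_pure q m'.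
Proof. by rewrite -tensor_piD; exact/tens_piP/tensor_rel_addr. Qed.

Lemma tensor_pure_bal q b m : tensor_pure (ract q b) m = tensor_pure q (b *: m).
Proof. exact/tens_piP/tensor_rel_bal. Qed.

Lemma tensor_pure_spanP (P : tensor_type -> Prop) :
  P 0 -> (forall q m x, P x -> P (tensor_pure q m + x)) -> forall x, P x.
Proof.
move=> P0 PD; elim/tensor_ind => s; rewrite tensor_piE.
by elim: s => [|p s ih]; rewrite ?big_nil ?big_cons; auto.
Qed.

Lemma tensor_scale_tens c q m : tensor_scale c (tensor_pure q m) = tensor_pure (c *: q) m.
Proof. exact: tensor_scaleE. Qed.

Lemma tensor_ract_tens q m a : tensor_ract (tensor_pure q m) a = tensor_pure q (ract m a).
Proof. exact: tensor_ractE. Qed.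

Lemma tensor_scaleD c : {morph tensor_scale c : x y / x + y}.
Proof.
elim/tensor_ind=> s; elim/tensor_ind=> t.
by rewrite -tensor_piD !tensor_scaleE map_cat tensor_piD.
Qed.

Lemma tensor_ractD a : {morph tensor_ract^~ a : x y / x + y}.
Proof.
elim/tensor_ind=> s; elim/tensor_ind=> t.
by rewrite -tensor_piD !tensor_ractE map_cat tensor_piD.
Qed.

Let tensor_scale0 c : tensor_scale c 0 = 0.
Proof. exact: tensor_scaleE. Qed.

Let tensor_ract0 a : tensor_ract 0 a = 0.
Proof. exact: tensor_ractE. Qed.

Fact tensor_scaleA a b x :
  tensor_scale a (tensor_scale b x) = tensor_scale (a * b) x.
Proof.
elim/tensor_pure_spanP: x => [|q m x ih]; first by rewrite !tensor_scale0.
by rewrite !tensor_scaleD ih !tensor_scale_tens scalerA.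
Qed.

Fact tensor_scale1 : left_id 1 tensor_scale.
Proof.
elim/tensor_pure_spanP => [|q m x ih]; first by rewrite !tensor_scale0.
by rewrite !tensor_scaleD ih !tensor_scale_tens scale1r.
Qed.

Fact tensor_scaleDr : right_distributive tensor_scale +%R.
Proof. by move=> c x y; rewrite tensor_scaleD. Qed.

Fact tensor_scaleDl x : {morph tensor_scale^~ x : a b / a + b}.
Proof.
move=> a b; elim/tensor_pure_spanP: x => [|q m x ih].
  by rewrite !tensor_scale0 addr0.
by rewrite !tensor_scaleD ih !tensor_scale_tens scalerDl tensor_pureDl addrACA.
Qed.

HB.instance Definition _ := GRing.Zmodule_isLmodule.Build C tensor_type
  tensor_scaleA tensor_scale1 tensor_scaleDr tensor_scaleDl.

Lemma tensor_pureZl c q m : tensor_pure (c *: q) m = c *: tensor_pure q m.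
Proof. by rewrite [RHS]tensor_scale_tens. Qed.

Fact tensor_ractDr x a b :
  tensor_ract x (a + b) = tensor_ract x a + tensor_ract x b.
Proof.
elim/tensor_pure_spanP: x => [|q m x ih]; first by rewrite !tensor_ract0 addr0.
by rewrite !tensor_ractD ih !tensor_ract_tens ractDr tensor_pureDr addrACA.
Qed.

Fact tensor_ract1 x : tensor_ract x 1 = x.
Proof.
elim/tensor_pure_spanP: x => [|q m x ih]; first by rewrite !tensor_ract0.
by rewrite !tensor_ractD ih !tensor_ract_tens ract1.
Qed.

Fact tensor_ractM x a b :
  tensor_ract x (a * b) = tensor_ract (tensor_ract x a) b.
Proof.
elim/tensor_pure_spanP: x => [|q m x ih]; first by rewrite !tensor_ract0.
by rewrite !tensor_ractD ih !tensor_ract_tens ractM.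
Qed.

Fact tensor_scaler_ract c x a :
  c *: tensor_ract x a = tensor_ract (c *: x) a.
Proof.
elim/tensor_pure_spanP: x => [|q m x ih].
  by rewrite scaler0 !tensor_ract0 scaler0.
by rewrite !(tensor_ractD, scalerDr) ih -!tensor_pureZl !tensor_ract_tens tensor_pureZl.
Qed.

Definition tensor : bimodule C A :=
  @Bimodule C A tensor_type tensor_ract (fun x y a => tensor_ractD a x y)
    tensor_ractDr tensor_ract1 tensor_ractM tensor_scaler_ract.

Definition tens (q : Q) (m : M) : tensor := tensor_pure q m.

Lemma tensDl q q' m : tens (q + q') m = tens q m + tens q' m.
Proof. exact: tensor_pureDl. Qed.

Lemma tensDr q m m' : tens q (m + m') = tens q m + tens q m'.
Proof. exact: tensor_pureDr. Qed.

Lemma tens_bal q b m : tens (ract q b) m = tens q (b *: m).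
Proof. exact: tensor_pure_bal. Qed.

Lemma tensZl c q m : tens (c *: q) m = c *: tens q m.
Proof. exact: tensor_pureZl. Qed.

Lemma tensR q m a : tens q (ract m a) = ract (tens q m) a.
Proof. by rewrite [RHS]tensor_ract_tens. Qed.

Lemma tensor_spanP (P : tensor -> Prop) :
  P 0 -> (forall q m x, P x -> P (tens q m + x)) -> forall x, P x.
Proof. exact: tensor_pure_spanP. Qed.

(* The additive map induced by a balanced biadditive f, see tensor_liftE.     *)
Definition tensor_lift (G : zmodType) (f : Q -> M -> G) (x : tensor) : G :=
  \sum_(p <- repr (x : tensor_type)) f p.1 p.2.

Definition balanced (G : zmodType) (f : Q -> M -> G) :=
  [/\ forall q q' m, f (q + q') m = f q m + f q' m,
      forall q m m', f q (m + m') = f q m + f q m' &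
      forall q b m, f (ract q b) m = f q (b *: m)].

Lemma tensor_lift_pi (G : zmodType) (f : Q -> M -> G) s : balanced f ->
  tensor_lift f (\pi_tensor_type s) = \sum_(p <- s) f p.1 p.2.
Proof.
move=> [fDl fDr fbal]; rewrite /tensor_lift.
move: (tensor_reprP s); move: (repr _) => r.
elim=> {r s} //.
- by move=> s t u _ -> _ ->.
- by move=> s s' t t' _ ih1 _ ih2; rewrite !big_cat /= ih1 ih2.
- by move=> s t; rewrite !big_cat /= addrC.
- move=> m; rewrite big_seq1 big_nil /=.
  by apply: (addrI (f 0 m)); rewrite -fDl !addr0.
- by move=> q q' m; rewrite !big_cons !big_nil /= fDl !addr0.
- by move=> q m m'; rewrite !big_cons !big_nil /= fDr !addr0.
- by move=> q b m; rewrite !big_cons !big_nil /= fbal.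
Qed.

Lemma tensor_liftE (G : zmodType) (f : Q -> M -> G) q m :
  balanced f -> tensor_lift f (tens q m) = f q m.
Proof. by move=> fb; rewrite tensor_lift_pi// big_seq1. Qed.

Lemma tensor_liftD (G : zmodType) (f : Q -> M -> G) : balanced f ->
  {morph tensor_lift f : x y / x + y}.
Proof.
move=> fb; elim/tensor_ind=> s; elim/tensor_ind=> t.
by rewrite -tensor_piD !tensor_lift_pi// big_cat.
Qed.

End Tensor.

Arguments tens {C B A Q M} q m.
Arguments tensor_lift {C B A Q M G} f x.

Section TensorMaps.
Variables (D C B A : pzRingType).

Lemma additive0 (U V : zmodType) (f : U -> V) :
  {morph f : x y / x + y} -> f 0 = 0.
Proof. by move=> fD; apply: (addrI (f 0)); rewrite -fD !addr0. Qed.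

Definition id_tensor (Q : bimodule C B) (P N : bimodule B A) (theta : P -> N) :
    tensor Q P -> tensor Q N :=
  tensor_lift (fun q p => tens q (theta p)).

Lemma id_tensorE (Q : bimodule C B) (P N : bimodule B A) (theta : P -> N) q p :
  {morph theta : x y / x + y} -> (forall b x, theta (b *: x) = b *: theta x) ->
  id_tensor theta (tens q p : tensor Q P) = tens q (theta p).
Proof.
move=> tD tZ; rewrite /id_tensor tensor_liftE//; split=> *.
- by rewrite tensDl.
- by rewrite tD tensDr.
- by rewrite tZ tens_bal.
Qed.

Definition tensor_id (Q Q' : bimodule C B) (M : bimodule B A) (f : Q -> Q') :
    tensor Q M -> tensor Q' M :=
  tensor_lift (fun q m => tens (f q) m).

Lemma tensor_id_balanced (Q Q' : bimodule C B) (M : bimodule B A)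
    (f : bimodule_map Q Q') :
  balanced (fun (q : Q) (m : M) => tens (f q) m : tensor Q' M).
Proof.
split=> *.
- by rewrite bimodule_mapD tensDl.
- by rewrite tensDr.
- by rewrite bimodule_mapR tens_bal.
Qed.

Lemma tensor_idE (Q Q' : bimodule C B) (M : bimodule B A)
    (f : bimodule_map Q Q') q m :
  tensor_id f (tens q m : tensor Q M) = tens (f q) m.
Proof. by rewrite /tensor_id (tensor_liftE _ _ (tensor_id_balanced M f)). Qed.

Lemma tensor_idD (Q Q' : bimodule C B) (M : bimodule B A)
    (f : bimodule_map Q Q') :
  {morph (tensor_id f : tensor Q M -> _) : x y / x + y}.
Proof. exact: tensor_liftD (tensor_id_balanced M f). Qed.

Definition tensor_assoc (P : bimodule D C) (Q : bimodule C B)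
    (M : bimodule B A) : tensor (tensor P Q) M -> tensor P (tensor Q M) :=
  tensor_lift (fun t m => tensor_lift (fun p q => tens p (tens q m)) t).

Fact tensor_assoc_bal (P : bimodule D C) (Q : bimodule C B)
    (M : bimodule B A) (m : M) :
  balanced (fun (p : P) (q : Q) => tens p (tens q m)).
Proof.
split=> *; [by rewrite tensDl | by rewrite tensDl tensDr |].
by rewrite tens_bal tensZl.
Qed.

Fact tensor_assoc_balanced (P : bimodule D C) (Q : bimodule C B)
    (M : bimodule B A) :
  balanced (fun (t : tensor P Q) (m : M) =>
    tensor_lift (fun p q => tens p (tens q m)) t).
Proof.
have bal := @tensor_assoc_bal P Q M; split.
- by move=> t t' m'; rewrite tensor_liftD.
- move=> t m1 m2; elim/tensor_spanP: t => [|p' q' x ih].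
    by rewrite !(additive0 (tensor_liftD (bal _))) addr0.
  by rewrite !(tensor_liftD (bal _)) ih !tensor_liftE// !tensDr addrACA.
- move=> t b m'; elim/tensor_spanP: t => [|p' q' x ih].
    by rewrite ract0l !(additive0 (tensor_liftD (bal _))).
  rewrite ractDl !(tensor_liftD (bal _)) ih -tensR !tensor_liftE//.
  by rewrite tens_bal.
Qed.

Lemma tensor_assocE (P : bimodule D C) (Q : bimodule C B) (M : bimodule B A)
    (p : P) (q : Q) (m : M) :
  tensor_assoc (tens (tens p q) m) = tens p (tens q m).
Proof.
rewrite /tensor_assoc (tensor_liftE _ _ (tensor_assoc_balanced P Q M)).
by rewrite (tensor_liftE _ _ (tensor_assoc_bal P Q m)).
Qed.

Lemma tensor_assocD (P : bimodule D C) (Q : bimodule C B) (M : bimodule B A) :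
  {morph (@tensor_assoc P Q M) : x y / x + y}.
Proof. exact: tensor_liftD (tensor_assoc_balanced P Q M). Qed.

Definition tensor_assocV (P : bimodule D C) (Q : bimodule C B)
    (M : bimodule B A) : tensor P (tensor Q M) -> tensor (tensor P Q) M :=
  tensor_lift (fun p t =>
    tensor_lift (fun q m => tens (tens p q : tensor P Q) m) t).

Fact tensor_assocV_bal (P : bimodule D C) (Q : bimodule C B)
    (M : bimodule B A) (p : P) :
  balanced (fun (q : Q) (m : M) => tens (tens p q) m).
Proof.
split=> *; [by rewrite tensDr tensDl | by rewrite tensDr |].
by rewrite tensR tens_bal.
Qed.

Fact tensor_assocV_balanced (P : bimodule D C) (Q : bimodule C B)
    (M : bimodule B A) :
  balanced (fun (p : P) (t : tensor Q M) =>
    tensor_lift (fun q m => tens (tens p q) m) t).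
Proof.
have bal := @tensor_assocV_bal P Q M; split.
- move=> p1 p2 t; elim/tensor_spanP: t => [|q' m' x ih].
    by rewrite !(additive0 (tensor_liftD (bal _))) addr0.
  by rewrite !(tensor_liftD (bal _)) ih !tensor_liftE// !tensDl addrACA.
- by move=> p' t t'; rewrite tensor_liftD.
- move=> p' c t; elim/tensor_spanP: t => [|q' m' x ih].
    by rewrite scaler0 !(additive0 (tensor_liftD (bal _))).
  rewrite scalerDr !(tensor_liftD (bal _)) ih -tensZl !tensor_liftE//.
  by rewrite tens_bal.
Qed.

Lemma tensor_assocVE (P : bimodule D C) (Q : bimodule C B) (M : bimodule B A)
    (p : P) (q : Q) (m : M) :
  tensor_assocV (tens p (tens q m)) = tens (tens p q) m.
Proof.
rewrite /tensor_assocV (tensor_liftE _ _ (tensor_assocV_balanced P Q M)).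
by rewrite (tensor_liftE _ _ (tensor_assocV_bal Q M p)).
Qed.

Lemma tensor_assocVD (P : bimodule D C) (Q : bimodule C B) (M : bimodule B A) :
  {morph (@tensor_assocV P Q M) : x y / x + y}.
Proof. exact: tensor_liftD (tensor_assocV_balanced P Q M). Qed.

End TensorMaps.

Section Connections.

(* Linearity over the constants is implied by the Leibniz rule, since dB      *)
(* vanishes on constants.                                                     *)
Definition is_left_connection (B A : pzRingType) (OmB : bimodule B B)
    (dB : B -> OmB) (M : bimodule B A) (nabla : M -> tensor OmB M) :=
  {morph nabla : x y / x + y} /\
  forall b m, nabla (b *: m) = tens (dB b) m + b *: nabla m.

Definition is_bimodule_connection (B A : pzRingType) (OmB : bimodule B B)
    (dB : B -> OmB) (OmA : bimodule A A) (dA : A -> OmA) (M : bimodule B A)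
    (nabla : M -> tensor OmB M)
    (sigma : bimodule_map (tensor M OmA) (tensor OmB M)) :=
  is_left_connection dB nabla /\
  forall m a, nabla (ract m a) = ract (nabla m) a + sigma (tens m (dA a)).

(* nabla(q (x) m) = nablaQ q (x) m + (sigmaQ (x) id)(q (x) nablaM m), see     *)
(* tensor_connectionE; the associators are written out.                       *)
Definition tensor_connection (C B A : pzRingType) (OmC : bimodule C C)
    (OmB : bimodule B B) (Q : bimodule C B) (M : bimodule B A)
    (nablaQ : Q -> tensor OmC Q)
    (sigmaQ : bimodule_map (tensor Q OmB) (tensor OmC Q))
    (nablaM : M -> tensor OmB M) : tensor Q M -> tensor OmC (tensor Q M) :=
  tensor_lift (fun q m =>
    tensor_assoc (tens (nablaQ q) m) +
    tensor_assoc (tensor_id sigmaQ (tensor_assocV (tens q (nablaM m))))).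

Section TensorConnection.
Variables (C B A : pzRingType) (OmC : bimodule C C) (dC : C -> OmC).
Variables (OmB : bimodule B B) (dB : B -> OmB).
Variables (Q : bimodule C B) (M : bimodule B A).
Variables (nablaQ : Q -> tensor OmC Q).
Variables (sigmaQ : bimodule_map (tensor Q OmB) (tensor OmC Q)).
Variables (nablaM : M -> tensor OmB M).
Hypothesis cQ : is_bimodule_connection dC dB nablaQ sigmaQ.
Hypothesis cM : is_left_connection dB nablaM.

Fact tensor_connection_balanced : balanced (fun (q : Q) (m : M) =>
  tensor_assoc (tens (nablaQ q) m) +
  tensor_assoc (tensor_id sigmaQ (tensor_assocV (tens q (nablaM m))))).
Proof.
case: cQ cM => -[QD _] QR [MD ML]; split.
- move=> q q' m; rewrite QD !tensDl tensor_assocVD tensor_idD.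
  by rewrite !tensor_assocD addrACA.
- move=> q m m'; rewrite MD !tensDr tensor_assocVD tensor_idD.
  by rewrite !tensor_assocD addrACA.
- move=> q b m; rewrite QR ML tensDr tensDl tensor_assocVD tensor_idD.
  rewrite !tensor_assocD !tens_bal -!addrA; congr (_ + _).
  by rewrite tensor_assocVE tensor_idE.
Qed.

Lemma tensor_connectionE q m : tensor_connection nablaQ sigmaQ nablaM (tens q m)
  = tensor_assoc (tens (nablaQ q) m) +
    tensor_assoc (tensor_id sigmaQ (tensor_assocV (tens q (nablaM m)))).
Proof. exact: tensor_liftE tensor_connection_balanced. Qed.

Lemma tensor_connectionD :
  {morph tensor_connection nablaQ sigmaQ nablaM : x y / x + y}.
Proof. exact: tensor_liftD tensor_connection_balanced. Qed.

End TensorConnection.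

(* D(theta) = nablaN theta - (id (x) theta) nablaP                            *)
Definition connection_defect (B A : pzRingType) (OmB : bimodule B B)
    (P N : bimodule B A) (nablaP : P -> tensor OmB P)
    (nablaN : N -> tensor OmB N) (theta : P -> N) (x : P) : tensor OmB N :=
  nablaN (theta x) - id_tensor theta (nablaP x).

End Connections.

Section DifferentiableComplements.
Variable R : realType.

Lemma near_eq_differentiable (V W : normedModType R) (f g : V -> W) (x : V) :
  {near x, f =1 g} -> differentiable f x -> differentiable g x.
Proof.
move=> fg df; have gx : f x = g x by exact: nbhs_singleton fg.
have dg : g \o shift x = cst (g x) + 'd f x +o_ 0 id.
  apply/eqaddoP => e e0.
  have /eqaddoP/(_ _ e0) dfo := diff_locally df.
  have fgs : \forall y \near 0, f (y + x) = g (y + x).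
    by move: fg; rewrite (near_shift 0 x) /=; apply: filterS => y; rewrite subr0.
  by apply: filterS2 fgs dfo => y; rewrite !fctE /= => ->; rewrite gx.
have dE : 'd g x = 'd f x :> (V -> W).
  by apply: diff_unique => //; exact: diff_continuous.
by apply/diff_locallyP; rewrite dE; split=> //; exact: diff_continuous.
Qed.

Lemma differentiable_rV m n (h : 'rV[R]_m -> 'rV[R]_n) x :
  (forall j, differentiable (fun z => h z 0 j) x) -> differentiable h x.
Proof.
move=> dh.
have -> : h = \sum_(j < n) (fun z => h z 0 j *: (delta_mx 0 j : 'rV[R]_n)).
  by apply/funext => z; rewrite fct_sumE; exact: row_sum_delta.
by apply: differentiable_sum => j; exact: differentiableZl.
Qed.

Lemma derive_comp_rV m n (h : 'rV[R]_m -> 'rV[R]_n) (g : 'rV[R]_n -> R) x v :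
  (forall j, differentiable (fun z => h z 0 j) x) -> differentiable g (h x) ->
  'D_v (g \o h) x =
  \sum_(j < n) 'D_v (fun z => h z 0 j) x * 'D_(delta_mx 0 j) g (h x).
Proof.
move=> dhj dg; have dh := differentiable_rV dhj.
rewrite deriveE; last exact: differentiable_comp.
rewrite diff_comp//= (row_sum_delta ('d h x v)) linear_sum /=.
apply: eq_bigr => j _; rewrite linearZ /= (deriveE _ dg); congr (_ * _).
rewrite (deriveE _ (dhj j)).
have @cj : {linear 'rV[R]_n -> R}.
  by exists (fun N : 'rV[R]_n => N 0 j); do 2![eexists]; do ?[constructor];
     rewrite ?mxE// => ? *; rewrite ?mxE//; move=> ?; rewrite !mxE.
have cjc : continuous cj by exact: coord_continuous.
have -> : 'd (fun z => h z 0 j) x = 'd cj (h x) \o 'd h x :> (_ -> _).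
  by rewrite -[fun z => _]/(cj \o h) (diff_comp dh)//;
    exact: differentiable_coord.
by rewrite /= (diff_lin _ cjc).
Qed.

End DifferentiableComplements.

Section SmoothFunctions.
Variable R : realType.

(* k-fold (Frechet) differentiability on the open set O; smooth_on is C^oo.   *)
Fixpoint diffn k n (O : set 'rV[R]_n) (f : 'rV[R]_n -> R) : Prop :=
  if k is k'.+1 then
    (forall x, O x -> differentiable f x) /\
    forall i, diffn k' O (fun x => 'D_(delta_mx 0 i) f x)
  else True.

Definition smooth_on n (O : set 'rV[R]_n) (f : 'rV[R]_n -> R) :=
  forall k, diffn k O f.

Lemma diffn_eq k n (O : set 'rV[R]_n) f g :
  open O -> (forall x, O x -> f x = g x) -> diffn k O f -> diffn k O g.
Proof.
move=> oO; elim: k f g => //= k ih f g fg [df dfk].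
have nfg x : O x -> {near x, f =1 g}.
  by move=> Ox; near=> y; apply: fg; near: y; exact: open_nbhs_nbhs.
split=> [x Ox|i]; first exact: near_eq_differentiable (nfg x Ox) (df x Ox).
apply: ih (dfk i) => x Ox; apply: near_eq_derive; exact: nfg.
Unshelve. all: by end_near. Qed.

Lemma diffn_sub k n (O V : set 'rV[R]_n) f :
  V `<=` O -> diffn k O f -> diffn k V f.
Proof.
move=> OV; elim: k f => //= k ih f [df dfk].
by split=> [x /OV/df//|i]; exact: ih (dfk i).
Qed.

Lemma diffn_mono k n (O : set 'rV[R]_n) f : diffn k.+1 O f -> diffn k O f.
Proof.
by elim: k f => // k ih f [df dfk]; split => // i; exact: ih (dfk i).
Qed.

Lemma diffn_cst k n (O : set 'rV[R]_n) (a : R) : diffn k O (cst a).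
Proof.
elim: k a => //= k ih a; split=> [x _|i]; first exact: differentiable_cst.
rewrite [X in diffn _ _ X](_ : _ = cst 0)//.
by apply/funext => x; rewrite derive_cst.
Qed.

Lemma diffnD k n (O : set 'rV[R]_n) f g : open O ->
  diffn k O f -> diffn k O g -> diffn k O (fun x => f x + g x).
Proof.
move=> oO; elim: k f g => //= k ih f g [df dfk] [dg dgk].
split=> [x Ox|i]; first exact: differentiableD (df _ Ox) (dg _ Ox).
apply: diffn_eq (ih _ _ (dfk i) (dgk i)) => // x Ox.
by rewrite -deriveD//; apply: diff_derivable; [exact: df|exact: dg].
Qed.

Lemma diffnM k n (O : set 'rV[R]_n) f g : open O ->
  diffn k O f -> diffn k O g -> diffn k O (fun x => f x * g x).
Proof.
move=> oO; elim: k f g => // k ih f g dfk1 dgk1.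
have [dfk dgk] := (diffn_mono dfk1, diffn_mono dgk1).
case: dfk1 dgk1 => /= df df' [dg dg'].
split=> [x Ox|i]; first exact: differentiableM (df _ Ox) (dg _ Ox).
apply: diffn_eq (diffnD oO (ih _ _ dfk (dg' i)) (ih _ _ dgk (df' i))) => //.
by move=> x Ox; rewrite -deriveM//; apply: diff_derivable;
  [exact: df|exact: dg].
Qed.

Lemma diffnN k n (O : set 'rV[R]_n) f : open O ->
  diffn k O f -> diffn k O (fun x => - f x).
Proof.
move=> oO df; apply: diffn_eq (diffnM oO (diffn_cst k O (-1)) df) => // x _.
by rewrite mulN1r.
Qed.

Lemma diffn_sum k n p (O : set 'rV[R]_n) (f : 'I_p -> 'rV[R]_n -> R) :
  open O -> (forall j, diffn k O (f j)) ->
  diffn k O (fun x => \sum_j f j x).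
Proof.
move=> oO df; rewrite [X in diffn _ _ X](_ : _ = \sum_j f j).
  elim/big_ind : _ => // [|g h ? ?]; [exact: diffn_cst|exact: diffnD].
by apply/funext => x; rewrite fct_sumE.
Qed.

Lemma diffn_comp k m n (O : set 'rV[R]_m) (V : set 'rV[R]_n)
    (h : 'rV[R]_m -> 'rV[R]_n) g :
  open O -> (forall x, O x -> V (h x)) ->
  (forall j, smooth_on O (fun x => h x 0 j)) -> diffn k V g ->
  diffn k O (g \o h).
Proof.
move=> oO hO sh; elim: k g => // k ih g [dg dgk].
have dh x j : O x -> differentiable (fun x => h x 0 j) x.
  by move=> Ox; have [+ _] := sh j 1; apply.
split=> [x Ox|i].
  apply: differentiable_comp (dg _ (hO _ Ox)).
  by apply: differentiable_rV => j; exact: dh.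
apply: (@diffn_eq _ _ _ (fun x => \sum_j
    'D_(delta_mx 0 i) (fun z => h z 0 j) x * 'D_(delta_mx 0 j) g (h x))) => //.
  move=> x Ox; rewrite derive_comp_rV//; first by move=> j; exact: dh.
  exact/dg/hO.
apply: diffn_sum => // j; apply: diffnM => //; last exact: ih (dgk j).
by have [_ ] := sh j k.+1; apply.
Qed.

Definition csmooth_on n (O : set 'rV[R]_n) (f : 'rV[R]_n -> R[i]) :=
  smooth_on O (fun x => complex.Re (f x)) /\
  smooth_on O (fun x => complex.Im (f x)).

Definition cderiv n (i : 'I_n) (f : 'rV[R]_n -> R[i]) (x : 'rV[R]_n) : R[i] :=
  Complex ('D_(delta_mx 0 i) (fun z => complex.Re (f z)) x)
          ('D_(delta_mx 0 i) (fun z => complex.Im (f z)) x).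

End SmoothFunctions.

Section ComplexSmoothTheory.
Variable R : realType.
Implicit Types n : nat.

Lemma ReM (x y : R[i]) : complex.Re (x * y) =
  complex.Re x * complex.Re y - complex.Im x * complex.Im y.
Proof. by case: x y => [a b] [c d]. Qed.

Lemma ImM (x y : R[i]) : complex.Im (x * y) =
  complex.Re x * complex.Im y + complex.Im x * complex.Re y.
Proof. by case: x y => [a b] [c d]. Qed.

Lemma ReD (x y : R[i]) : complex.Re (x + y) = complex.Re x + complex.Re y.
Proof. by case: x y => [a b] [c d]. Qed.

Lemma ImD (x y : R[i]) : complex.Im (x + y) = complex.Im x + complex.Im y.
Proof. by case: x y => [a b] [c d]. Qed.

Lemma complexP (x y : R[i]) :
  complex.Re x = complex.Re y -> complex.Im x = complex.Im y -> x = y.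
Proof. by case: x y => [a b] [c d] /= -> ->. Qed.

Lemma Re_sum I (r : seq I) (F : I -> R[i]) :
  complex.Re (\sum_(i <- r) F i) = \sum_(i <- r) complex.Re (F i).
Proof. exact: (big_morph _ ReD). Qed.

Lemma Im_sum I (r : seq I) (F : I -> R[i]) :
  complex.Im (\sum_(i <- r) F i) = \sum_(i <- r) complex.Im (F i).
Proof. exact: (big_morph _ ImD). Qed.

Lemma csmooth_eq n (O : set 'rV[R]_n) (f g : 'rV[R]_n -> R[i]) :
  open O -> (forall x, O x -> f x = g x) -> csmooth_on O f -> csmooth_on O g.
Proof.
move=> oO fg [fr fi]; split=> k; [apply: diffn_eq (fr k)|apply: diffn_eq (fi k)];
  by move=> // x /fg ->.
Qed.

Lemma csmooth_sub n (O V : set 'rV[R]_n) (f : 'rV[R]_n -> R[i]) :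
  V `<=` O -> csmooth_on O f -> csmooth_on V f.
Proof. by move=> OV [fr fi]; split=> k; exact: diffn_sub OV _. Qed.

Lemma csmooth_cst n (O : set 'rV[R]_n) (a : R[i]) : csmooth_on O (fun=> a).
Proof. by split=> k; exact: diffn_cst. Qed.

Lemma csmoothD n (O : set 'rV[R]_n) (f g : 'rV[R]_n -> R[i]) : open O ->
  csmooth_on O f -> csmooth_on O g -> csmooth_on O (fun x => f x + g x).
Proof.
move=> oO [fr fi] [gr gi]; split=> k.
  by apply: diffn_eq (diffnD oO (fr k) (gr k)) => // x _; rewrite ReD.
by apply: diffn_eq (diffnD oO (fi k) (gi k)) => // x _; rewrite ImD.
Qed.

Lemma csmoothM n (O : set 'rV[R]_n) (f g : 'rV[R]_n -> R[i]) : open O ->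
  csmooth_on O f -> csmooth_on O g -> csmooth_on O (fun x => f x * g x).
Proof.
move=> oO [fr fi] [gr gi]; split=> k.
  apply: diffn_eq (diffnD oO (diffnM oO (fr k) (gr k))
    (diffnN oO (diffnM oO (fi k) (gi k)))) => // x _; by rewrite ReM.
apply: diffn_eq (diffnD oO (diffnM oO (fr k) (gi k))
  (diffnM oO (fi k) (gr k))) => // x _; by rewrite ImM.
Qed.

Lemma csmoothN n (O : set 'rV[R]_n) (f : 'rV[R]_n -> R[i]) : open O ->
  csmooth_on O f -> csmooth_on O (fun x => - f x).
Proof.
move=> oO sf; apply: csmooth_eq (csmoothM oO (csmooth_cst O (-1)) sf) => //.
by move=> x _; rewrite mulN1r.
Qed.

Lemma csmooth_comp m n (O : set 'rV[R]_m) (V : set 'rV[R]_n)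
    (h : 'rV[R]_m -> 'rV[R]_n) (g : 'rV[R]_n -> R[i]) :
  open O -> (forall x, O x -> V (h x)) ->
  (forall j, smooth_on O (fun x => h x 0 j)) -> csmooth_on V g ->
  csmooth_on O (g \o h).
Proof.
move=> oO hO sh [gr gi]; split=> k.
  exact: (diffn_comp oO hO sh (gr k)).
exact: (diffn_comp oO hO sh (gi k)).
Qed.

Lemma csmooth_cderiv n (O : set 'rV[R]_n) (f : 'rV[R]_n -> R[i]) i :
  csmooth_on O f -> csmooth_on O (cderiv i f).
Proof.
by move=> [fr fi]; split=> k; [have [_ +] := fr k.+1|have [_ +] := fi k.+1]; apply.
Qed.

Lemma diffn_local k n (O : set 'rV[R]_n) (f : 'rV[R]_n -> R) :
  (forall x, O x -> exists2 V, V x & diffn k V f) -> diffn k O f.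
Proof.
elim: k f => //= k ih f loc; split.
  by move=> x /loc [V Vx [dO _]]; exact: dO.
by move=> i; apply: ih => x /loc [V Vx [_ df]]; exists V.
Qed.

Lemma csmooth_local n (O : set 'rV[R]_n) (f : 'rV[R]_n -> R[i]) :
  (forall x, O x -> exists2 V, V x & csmooth_on V f) -> csmooth_on O f.
Proof.
by move=> loc; split=> k; apply: diffn_local => x /loc [V Vx [fr fi]];
  exists V.
Qed.

Lemma cderiv_eq n (O : set 'rV[R]_n) i (f g : 'rV[R]_n -> R[i]) x :
  open O -> O x -> (forall z, O z -> f z = g z) -> cderiv i f x = cderiv i g x.
Proof.
move=> oO Ox fg; have nfg : \near x, f x = g x.
  by near=> y; apply: fg; near: y; exact: open_nbhs_nbhs.
by congr Complex; apply: near_eq_derive; apply: filterS nfg => y ->.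
Unshelve. all: by end_near. Qed.

Lemma cderiv_cst n i (a : R[i]) (x : 'rV[R]_n) : cderiv i (fun=> a) x = 0.
Proof. by rewrite /cderiv !derive_cst. Qed.

Lemma csmooth_derivable n (O : set 'rV[R]_n) (f : 'rV[R]_n -> R[i]) x :
  csmooth_on O f -> O x ->
  differentiable (fun z => complex.Re (f z)) x /\
  differentiable (fun z => complex.Im (f z)) x.
Proof.
by move=> [/(_ 1)[fr _] /(_ 1)[fi _]] Ox; split; [exact: fr|exact: fi].
Qed.

Lemma cderivD n (O : set 'rV[R]_n) i (f g : 'rV[R]_n -> R[i]) x :
  O x -> csmooth_on O f -> csmooth_on O g ->
  cderiv i (fun z => f z + g z) x = cderiv i f x + cderiv i g x.
Proof.
move=> Ox /csmooth_derivable/(_ Ox)[fr fi] /csmooth_derivable/(_ Ox)[gr gi].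
apply: complexP; rewrite ?ReD ?ImD /=.
  rewrite -deriveD; try exact: diff_derivable.
  by congr ('D_ _ _ x); apply/funext => z; rewrite ReD.
rewrite -deriveD; try exact: diff_derivable.
by congr ('D_ _ _ x); apply/funext => z; rewrite ImD.
Qed.

Lemma deriveM_mul n (f g : 'rV[R]_n -> R) x v :
  differentiable f x -> differentiable g x ->
  'D_v (fun z => f z * g z) x = f x * 'D_v g x + g x * 'D_v f x.
Proof. by move=> df dg; rewrite deriveM//; exact: diff_derivable. Qed.

Lemma cderivM n (O : set 'rV[R]_n) i (f g : 'rV[R]_n -> R[i]) x :
  O x -> csmooth_on O f -> csmooth_on O g ->
  cderiv i (fun z => f z * g z) x = f x * cderiv i g x + g x * cderiv i f x.
Proof.
move=> Ox /csmooth_derivable/(_ Ox)[fr fi] /csmooth_derivable/(_ Ox)[gr gi].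
pose fR z := complex.Re (f z); pose fI z := complex.Im (f z).
pose gR z := complex.Re (g z); pose gI z := complex.Im (g z).
have dM (h k : 'rV[R]_n -> R) : differentiable h x -> differentiable k x ->
    derivable (fun z => h z * k z) x (delta_mx 0 i).
  by move=> dh dk; apply: derivableM; exact: diff_derivable.
apply: complexP; rewrite ?ReD ?ImD ?ReM ?ImM /=.
  have -> : (fun z => complex.Re (f z * g z)) =
      (fun z => fR z * gR z) - (fun z => fI z * gI z).
    by apply/funext => z; rewrite ReM.
  rewrite deriveB; [|exact: (dM fR gR)|exact: (dM fI gI)].
  rewrite (deriveM_mul (f := fR))// (deriveM_mul (f := fI))//.
  by rewrite opprD addrACA.
have -> : (fun z => complex.Im (f z * g z)) =
    (fun z => fR z * gI z) + (fun z => fI z * gR z).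
  by apply/funext => z; rewrite ImM.
rewrite deriveD; [|exact: (dM fR gI)|exact: (dM fI gR)].
rewrite (deriveM_mul (f := fR))// (deriveM_mul (f := fI))//.
by rewrite addrACA; congr (_ + _); exact: addrC.
Qed.

Lemma cderiv_comp m n (O : set 'rV[R]_m) (V : set 'rV[R]_n)
    (h : 'rV[R]_m -> 'rV[R]_n) (g : 'rV[R]_n -> R[i]) x i :
  O x -> V (h x) -> (forall j, smooth_on O (fun x => h x 0 j)) ->
  csmooth_on V g ->
  cderiv i (g \o h) x =
  \sum_j cderiv j g (h x) * cderiv i (fun z => real_complex R (h z 0 j)) x.
Proof.
move=> Ox Ohx sh /csmooth_derivable/(_ Ohx)[gr gi].
have dh j : differentiable (fun x => h x 0 j) x by have [+ _] := sh j 1; apply.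
apply: complexP; rewrite ?Re_sum ?Im_sum [LHS]/=.
  rewrite -[fun z => _]/((fun z => complex.Re (g z)) \o h) derive_comp_rV//.
  by apply: eq_bigr => j _; rewrite ReM /= derive_cst mulr0 subr0 mulrC.
rewrite -[fun z => _]/((fun z => complex.Im (g z)) \o h) derive_comp_rV//.
by apply: eq_bigr => j _; rewrite ImM /= derive_cst mulr0 add0r mulrC.
Qed.

End ComplexSmoothTheory.

(* A chart is a homeomorphism of chart_dom onto an open subset of R^n; the    *)
(* values of chart_map outside chart_dom are irrelevant.                      *)
Record chart (R : realType) (n : nat) (T : topologicalType) := Chart {
  chart_map :> T -> 'rV[R]_n;
  chart_dom : set T;
  open_chart_dom : open chart_dom;
  chart_inj : forall p q, chart_dom p -> chart_dom q ->
    chart_map p = chart_map q -> p = q;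
  chart_continuous : forall p, chart_dom p -> {for p, continuous chart_map};
  chart_open : forall W, open W -> W `<=` chart_dom ->
    open (chart_map @` W) }.

Section Charts.
Variables (R : realType) (n : nat) (T : topologicalType).
Implicit Types (c : chart R n T) (W : set T) (f : T -> R[i]) (p : T).

(* The local representative f \o c^-1 on the image of c (and 0 elsewhere).    *)
Definition local_rep c f (z : 'rV[R]_n) : R[i] :=
  xget 0 (f @` (chart_dom c `&` c @^-1` [set z])).

Definition csmooth_via c W f :=
  csmooth_on (c @` (chart_dom c `&` W)) (local_rep c f).

Definition coordinate c (j : 'I_n) p : R[i] := real_complex R (c p 0 j).

Definition cpartial c i f p : R[i] := cderiv i (local_rep c f) (c p).

Definition chart_compatible c c' :=
  forall j, csmooth_via c (chart_dom c') (coordinate c' j).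

Lemma local_repE c f p : chart_dom c p -> local_rep c f (c p) = f p.
Proof.
move=> cp; rewrite /local_rep; case: xgetP => [_ -> [q [cq /= cqp] <-]|].
  by rewrite (chart_inj cq cp cqp).
by move/(_ (f p)) => /= nex; exfalso; apply: nex; exists p.
Qed.

Lemma open_chart_image c W : open W -> open (c @` (chart_dom c `&` W)).
Proof.
move=> oW; apply: chart_open; last exact: subIsetl.
by apply: openI oW; exact: open_chart_dom.
Qed.

Lemma csmooth_viaP c W f (g : 'rV[R]_n -> R[i]) : open W ->
  (forall p, chart_dom c p -> W p -> g (c p) = f p) ->
  csmooth_on (c @` (chart_dom c `&` W)) g -> csmooth_via c W f.
Proof.
move=> oW gf; apply: csmooth_eq; first exact: open_chart_image.
by move=> _ [p [cp Wp] <-]; rewrite local_repE// gf.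
Qed.

Lemma csmooth_via_sub c W W' f : W' `<=` W ->
  csmooth_via c W f -> csmooth_via c W' f.
Proof.
by move=> WW'; apply: csmooth_sub; apply: image_subset; apply: setIS.
Qed.

Lemma csmooth_via_eq c W f g : open W ->
  (forall p, chart_dom c p -> W p -> f p = g p) ->
  csmooth_via c W f -> csmooth_via c W g.
Proof.
by move=> oW fg; apply: csmooth_viaP => // p cp Wp; rewrite local_repE// fg.
Qed.

Lemma csmooth_via_local c W f :
  (forall p, chart_dom c p -> W p -> exists2 W', W' p & csmooth_via c W' f) ->
  csmooth_via c W f.
Proof.
move=> loc; apply: csmooth_local => _ [p [cp Wp] <-].
by have [W' W'p sf] := loc p cp Wp; exists (c @` (chart_dom c `&` W'));
  first by exists p.
Qed.

Lemma csmooth_via_cst c W (a : R[i]) : open W -> csmooth_via c W (fun=> a).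
Proof.
by move=> oW; apply: csmooth_viaP (csmooth_cst _ a).
Qed.

Lemma csmooth_viaD c W f g : open W -> csmooth_via c W f ->
  csmooth_via c W g -> csmooth_via c W (fun p => f p + g p).
Proof.
move=> oW sf sg; apply: csmooth_viaP (csmoothD _ sf sg) => //.
  by move=> p cp _; rewrite !local_repE.
exact: open_chart_image.
Qed.

Lemma csmooth_viaM c W f g : open W -> csmooth_via c W f ->
  csmooth_via c W g -> csmooth_via c W (fun p => f p * g p).
Proof.
move=> oW sf sg; apply: csmooth_viaP (csmoothM _ sf sg) => //.
  by move=> p cp _; rewrite !local_repE.
exact: open_chart_image.
Qed.

Lemma csmooth_viaN c W f : open W -> csmooth_via c W f ->
  csmooth_via c W (fun p => - f p).
Proof.
move=> oW sf; apply: csmooth_viaP (csmoothN _ sf) => //.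
  by move=> p cp _; rewrite !local_repE.
exact: open_chart_image.
Qed.

Lemma csmooth_cpartial c W i f : open W ->
  csmooth_via c W f -> csmooth_via c W (cpartial c i f).
Proof. by move=> oW sf; apply: csmooth_viaP (csmooth_cderiv i sf). Qed.

Lemma cpartial_eq c W i f g p : open W -> W p -> chart_dom c p ->
  (forall q, chart_dom c q -> W q -> f q = g q) ->
  cpartial c i f p = cpartial c i g p.
Proof.
move=> oW Wp cp fg; rewrite /cpartial.
apply: (@cderiv_eq _ _ (c @` (chart_dom c `&` W))).
- exact: open_chart_image.
- by exists p.
- by move=> _ [q [cq Wq] <-]; rewrite !local_repE// fg.
Qed.

Lemma cpartialD c W i f g p : open W -> W p -> chart_dom c p ->
  csmooth_via c W f -> csmooth_via c W g ->
  cpartial c i (fun q => f q + g q) p = cpartial c i f p + cpartial c i g p.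
Proof.
move=> oW Wp cp sf sg.
rewrite /cpartial -(cderivD (O := c @` (chart_dom c `&` W)))//; last first.
  by exists p.
apply: (@cderiv_eq _ _ (c @` (chart_dom c `&` W))).
- exact: open_chart_image.
- by exists p.
- by move=> _ [q [cq Wq] <-]; rewrite !local_repE.
Qed.

Lemma cpartialM c W i f g p : open W -> W p -> chart_dom c p ->
  csmooth_via c W f -> csmooth_via c W g ->
  cpartial c i (fun q => f q * g q) p =
  f p * cpartial c i g p + g p * cpartial c i f p.
Proof.
move=> oW Wp cp sf sg; rewrite -(local_repE f cp) -(local_repE g cp).
rewrite /cpartial -(cderivM (O := c @` (chart_dom c `&` W)))//; last first.
  by exists p.
apply: (@cderiv_eq _ _ (c @` (chart_dom c `&` W))).
- exact: open_chart_image.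
- by exists p.
- by move=> _ [q [cq Wq] <-]; rewrite !local_repE.
Qed.

End Charts.

Section ChartComposition.
Variables (R : realType) (m n : nat) (S T : topologicalType).
Variables (e : chart R m S) (c : chart R n T) (g : S -> T).
Variables (W : set S) (W' : set T).
Hypothesis oW : open W.
Hypothesis gW : forall q, chart_dom e q -> W q -> chart_dom c (g q) /\ W' (g q).
Hypothesis sg : forall j, csmooth_via e W (coordinate c j \o g).

Let h (z : 'rV[R]_m) : 'rV[R]_n :=
  \row_j complex.Re (local_rep e (coordinate c j \o g) z).

Let hE q : chart_dom e q -> h (e q) = c (g q).
Proof. by move=> eq; apply/rowP => j; rewrite mxE local_repE. Qed.

Let sh j : smooth_on (e @` (chart_dom e `&` W)) (fun z => h z 0 j).
Proof.
rewrite (_ : (fun z => _) = fun z => complex.Re (local_rep e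
  (coordinate c j \o g) z)); first by have [] := sg j.
by apply/funext => z; rewrite mxE.
Qed.

Lemma csmooth_via_comp f : csmooth_via c W' f -> csmooth_via e W (f \o g).
Proof.
move=> sf; apply: csmooth_viaP (csmooth_comp _ _ sh sf) => //.
- move=> q eq Wq /=; rewrite hE// local_repE//.
  by have [] := gW eq Wq.
- exact: open_chart_image.
- move=> _ [q [eq Wq] <-]; rewrite hE//; exists (g q) => //.
  exact: gW.
Qed.

Lemma cpartial_comp f q i : csmooth_via c W' f -> chart_dom e q -> W q ->
  cpartial e i (f \o g) q =
  \sum_j cpartial c j f (g q) * cpartial e i (coordinate c j \o g) q.
Proof.
move=> sf eq Wq; have oeW := @open_chart_image _ _ _ e W oW.
have eWq : (e @` (chart_dom e `&` W)) (e q) by exists q.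
have cWq : (c @` (chart_dom c `&` W')) (h (e q)).
  by rewrite hE//; exists (g q) => //; exact: gW.
rewrite /cpartial (@cderiv_eq _ _ _ i _ (local_rep c f \o h) _ oeW eWq).
  rewrite (cderiv_comp i eWq cWq sh sf) hE//; apply: eq_bigr => j _.
  congr (_ * _); apply: (cderiv_eq _ oeW eWq) => _ [r [er Wr] <-].
  by rewrite hE// local_repE.
move=> _ [r [er Wr] <-] /=; rewrite hE// !local_repE//.
by have [] := gW er Wr.
Qed.

End ChartComposition.

(* Smooth manifolds of dimension n: a Hausdorff second countable space with a *)
(* smooth atlas, not required to be maximal.                                  *)
Record manifold (R : realType) (n : nat) := Manifold {
  manifold_sort :> topologicalType;
  manifold_hausdorff : hausdorff_space manifold_sort;
  manifold_second_countable : @second_countable manifold_sort;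
  atlas_index : Type;
  atlas : atlas_index -> chart R n manifold_sort;
  atlas_cover : forall p, exists a, chart_dom (atlas a) p;
  atlas_compatible : forall a b, chart_compatible (atlas a) (atlas b) }.

Arguments atlas {R n} m _.

Section ManifoldFunctions.
Variables (R : realType) (n : nat) (X : manifold R n).
Implicit Types (a b : atlas_index X).

Definition is_smooth (f : X -> R[i]) :=
  forall a, csmooth_via (atlas X a) setT f.

Lemma csmooth_via_atlas a b W f : open W -> W `<=` chart_dom (atlas X a) ->
  csmooth_via (atlas X a) W f -> csmooth_via (atlas X b) W f.
Proof.
move=> oW Wa; apply: (csmooth_via_comp (g := id) oW) => [q _ Wq|j].
  by split=> //; exact: Wa.
by apply: csmooth_via_sub (atlas_compatible b a j).
Qed.

Lemma cpartial_atlas a b f p i : is_smooth f ->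
  chart_dom (atlas X a) p -> chart_dom (atlas X b) p ->
  cpartial (atlas X a) i f p =
  \sum_j cpartial (atlas X b) j f p *
         cpartial (atlas X a) i (coordinate (atlas X b) j) p.
Proof.
move=> sf ap bp.
apply: (@cpartial_comp _ _ _ _ _ (atlas X a) (atlas X b) id
  (chart_dom (atlas X b)) setT) => //.
- exact: open_chart_dom.
- by move=> j; exact: atlas_compatible.
Qed.

Definition smooth_function : {pred X -> R[i]} := fun f => `[< is_smooth f >].

Fact smooth_function_subring : subring_closed smooth_function.
Proof.
split=> [|f g /asboolP sf /asboolP sg|f g /asboolP sf /asboolP sg];
    apply/asboolP => a.
- exact: csmooth_via_cst openT.
- exact: csmooth_viaD openT (sf a) (csmooth_viaN openT (sg a)).
- exact: csmooth_viaM openT (sf a) (sg a).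
Qed.

Record Cinf := MkCinf {
  Cinf_fun :> X -> R[i];
  Cinf_funP : Cinf_fun \in smooth_function }.

HB.instance Definition _ := [isSub for Cinf_fun].
HB.instance Definition _ := [Choice of Cinf by <:].
HB.instance Definition _ := GRing.SubChoice_isSubComPzRing.Build
  _ _ Cinf smooth_function_subring.

Lemma CinfP (f : Cinf) : is_smooth f.
Proof. exact/asboolP/Cinf_funP. Qed.

Definition mkCinf (f : X -> R[i]) (sf : is_smooth f) : Cinf :=
  @MkCinf f (asboolT sf).

Lemma Cinf_eqP (f g : Cinf) : (forall p, f p = g p) -> f = g.
Proof. by move=> fg; apply/val_inj/funext. Qed.

Lemma CinfDE (f g : Cinf) p : (f + g) p = f p + g p. Proof. by []. Qed.
Lemma CinfME (f g : Cinf) p : (f * g) p = f p * g p. Proof. by []. Qed.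
Lemma CinfNE (f : Cinf) p : (- f) p = - f p. Proof. by []. Qed.
Lemma Cinf1E p : (1 : Cinf) p = 1. Proof. by []. Qed.

(* Complex valued 1-forms: om a p is the row of components at p of the form   *)
(* in the a-th chart.                                                         *)
Record is_form (om : atlas_index X -> X -> 'rV[R[i]]_n) : Prop := IsForm {
  form_outside : forall a p, ~ chart_dom (atlas X a) p -> om a p = 0;
  form_smooth : forall a i,
    csmooth_via (atlas X a) setT (fun p => om a p 0 i);
  form_transform : forall a b p i,
    chart_dom (atlas X a) p -> chart_dom (atlas X b) p ->
    om a p 0 i =
    \sum_j om b p 0 j * cpartial (atlas X a) i (coordinate (atlas X b) j) p }.

Definition smooth_form : {pred atlas_index X -> X -> 'rV[R[i]]_n} :=
  fun om => `[< is_form om >].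

Fact smooth_form_zmod : zmod_closed smooth_form.
Proof.
split=> [|om th /asboolP[u1 u2 u3] /asboolP[t1 t2 t3]]; apply/asboolP; split.
- by [].
- move=> a i; apply: (csmooth_via_eq openT _ (@csmooth_via_cst _ _ _ _ setT 0 openT)) => //.
  by move=> p _ _; rewrite mxE.
- by move=> a b p i _ _; rewrite mxE big1// => j _; rewrite mxE mul0r.
- by move=> a p ap; rewrite -[LHS]/(om a p - th a p) u1// t1// subr0.
- move=> a i; apply: csmooth_via_eq openT _ (csmooth_viaD openT (u2 a i)
    (csmooth_viaN openT (t2 a i))) => // p _ _.
  by rewrite -[in RHS]/(om a p - th a p) !mxE.
- move=> a b p i ap bp; rewrite -[in LHS]/(om a p - th a p) !mxE.
  rewrite (u3 a b)// (t3 a b)// -sumrB; apply: eq_bigr => j _.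
  by rewrite -[in RHS]/(om b p - th b p) !mxE mulrBl.
Qed.

Record form := MkForm {
  form_fun :> atlas_index X -> X -> 'rV[R[i]]_n;
  form_funP : form_fun \in smooth_form }.

HB.instance Definition _ := [isSub for form_fun].
HB.instance Definition _ := [Choice of form by <:].
HB.instance Definition _ := GRing.SubChoice_isSubZmodule.Build
  _ _ form smooth_form_zmod.

Lemma formP (om : form) : is_form om.
Proof. exact/asboolP/form_funP. Qed.

Definition mkform om (fom : is_form om) : form := @MkForm om (asboolT fom).

Lemma form_eqP (om th : form) : (forall a p, om a p = th a p) -> om = th.
Proof. by move=> omth; apply/val_inj/funext => a; apply/funext. Qed.

Fact form_scale_subproof (f : Cinf) (om : form) :
  is_form (fun a p => f p *: om a p).
Proof.
have [u1 u2 u3] := formP om; split.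
- by move=> a p ap; rewrite u1// scaler0.
- move=> a i.
  apply: csmooth_via_eq openT _ (csmooth_viaM openT (CinfP f a) (u2 a i)) => //.
  by move=> p _ _; rewrite mxE.
- move=> a b p i ap bp; rewrite mxE (u3 a b)// mulr_sumr.
  by apply: eq_bigr => j _; rewrite mxE mulrA.
Qed.

Definition form_scale f om := mkform (form_scale_subproof f om).

Fact form_scaleA f g om : form_scale f (form_scale g om) = form_scale (f * g) om.
Proof. by apply: form_eqP => a p /=; rewrite scalerA. Qed.

Fact form_scale1 : left_id 1 form_scale.
Proof. by move=> om; apply: form_eqP => a p /=; rewrite scale1r. Qed.

Fact form_scaleDr : right_distributive form_scale +%R.
Proof.
by move=> f om th; apply: form_eqP => a p; rewrite -[RHS]scalerDr.
Qed.

Fact form_scaleDl om : {morph form_scale^~ om : f g / f + g}.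
Proof. by move=> f g; apply: form_eqP => a p; rewrite -[RHS]scalerDl. Qed.

HB.instance Definition _ := GRing.Zmodule_isLmodule.Build Cinf form
  form_scaleA form_scale1 form_scaleDr form_scaleDl.

Definition form_ract (om : form) (f : Cinf) : form := f *: om.

Fact form_ractDl om th f :
  form_ract (om + th) f = form_ract om f + form_ract th f.
Proof. exact: scalerDr. Qed.

Fact form_ractDr om f g :
  form_ract om (f + g) = form_ract om f + form_ract om g.
Proof. exact: scalerDl. Qed.

Fact form_ract1 om : form_ract om 1 = om.
Proof. exact: scale1r. Qed.

Fact form_ractM om f g : form_ract om (f * g) = form_ract (form_ract om f) g.
Proof. by rewrite /form_ract scalerA mulrC. Qed.

Fact form_scaler_ract f om g :
  f *: form_ract om g = form_ract (f *: om) g.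
Proof. by rewrite /form_ract !scalerA mulrC. Qed.

(* The C^oo(X)-bimodule of 1-forms, with om f = f om.                         *)
Definition Omega1 : bimodule Cinf Cinf :=
  @Bimodule Cinf Cinf form form_ract form_ractDl form_ractDr form_ract1
    form_ractM form_scaler_ract.

Fact dform_subproof (f : Cinf) : is_form (fun a p =>
  if `[< chart_dom (atlas X a) p >]
  then \row_i cpartial (atlas X a) i f p else 0).
Proof.
split.
- by move=> a p /asboolPn/negbTE ->.
- move=> a i; apply: csmooth_via_eq openT _ (csmooth_cpartial i openT (CinfP f a)) => //.
  by move=> p /asboolT -> _; rewrite mxE.
- move=> a b p i ap bp; rewrite !asboolT// mxE (cpartial_atlas _ (CinfP f) ap bp).
  by apply: eq_bigr => j _; rewrite mxE.
Qed.

Definition dform (f : Cinf) : Omega1 := mkform (dform_subproof f).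

Lemma dformE f a p i : chart_dom (atlas X a) p ->
  (dform f : form) a p 0 i = cpartial (atlas X a) i f p.
Proof. by move=> ap; rewrite /dform /= asboolT// mxE. Qed.

Lemma form_ext (om th : form) :
  (forall a p i, chart_dom (atlas X a) p -> om a p 0 i = th a p 0 i) -> om = th.
Proof.
move=> E; apply: form_eqP => a p.
have [ap|nap] := pselect (chart_dom (atlas X a) p).
  by apply/rowP => i; exact: E.
by rewrite (form_outside (formP om) nap) (form_outside (formP th) nap).
Qed.

Lemma dformD : {morph dform : f g / f + g}.
Proof.
move=> f g; apply: form_ext => a p i ap; rewrite dformE//.
rewrite -[in RHS]/((dform f : form) a p + (dform g : form) a p) mxE !dformE//.
exact: (cpartialD _ openT I ap (CinfP f a) (CinfP g a)).
Qed.

Lemma dformM (f g : Cinf) : dform (f * g) = f *: dform g + g *: dform f.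
Proof.
apply: form_ext => a p i ap; rewrite dformE//.
rewrite -[in RHS]/(f p *: (dform g : form) a p + g p *: (dform f : form) a p).
rewrite !mxE !dformE//.
exact: (cpartialM _ openT I ap (CinfP f a) (CinfP g a)).
Qed.

End ManifoldFunctions.

Arguments dform {R n X} f.

Section Flip.
Variables (R : realType) (n : nat) (X : manifold R n).
Local Notation OmOm := (tensor (Omega1 X) (Omega1 X)).

Fact flip_balanced :
  balanced (fun xi et : Omega1 X => tens et xi : OmOm).
Proof.
split=> *; [by rewrite tensDr|by rewrite tensDl|].
by rewrite -tens_bal.
Qed.

Definition flip_fun : OmOm -> OmOm :=
  tensor_lift (fun xi et : Omega1 X => tens et xi).

Fact flipD x y : flip_fun (x + y) = flip_fun x + flip_fun y.
Proof. exact: (tensor_liftD flip_balanced). Qed.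

Fact flipZ f x : flip_fun (f *: x) = f *: flip_fun x.
Proof.
elim/tensor_spanP: x => [|xi et x ih].
  by rewrite scaler0 (additive0 flipD) scaler0.
rewrite scalerDr !flipD ih scalerDr; congr (_ + _).
rewrite -tensZl /flip_fun !(tensor_liftE _ _ flip_balanced) -tensZl.
by rewrite -[in RHS]/(ract et f) tens_bal.
Qed.

Fact flipR x f : flip_fun (ract x f) = ract (flip_fun x) f.
Proof.
elim/tensor_spanP: x => [|xi et x ih].
  by rewrite ract0l (additive0 flipD) ract0l.
rewrite ractDl !flipD ih ractDl; congr (_ + _).
rewrite -tensR /flip_fun !(tensor_liftE _ _ flip_balanced) -tensR.
by rewrite -tens_bal.
Qed.

Definition flip : bimodule_map OmOm OmOm := BimoduleMap flipD flipZ flipR.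

Lemma flipE (xi et : Omega1 X) : flip (tens xi et) = tens et xi.
Proof. exact: tensor_liftE flip_balanced. Qed.

Lemma ract_form2 (x : OmOm) f : ract x f = f *: x.
Proof.
elim/tensor_spanP: x => [|xi et x ih]; first by rewrite ract0l scaler0.
rewrite ractDl ih scalerDr -tensR -tensZl; congr (_ + _).
by rewrite -[RHS]/(tens (ract xi f) et) tens_bal.
Qed.

Lemma flip_bimodule_connection (nabla : Omega1 X -> OmOm) :
  is_left_connection dform nabla ->
  is_bimodule_connection dform dform nabla flip.
Proof.
move=> nablac; split=> // xi f; case: nablac => nablaD nablaL.
by rewrite -[ract xi f]/(f *: xi) nablaL flipE addrC ract_form2.
Qed.

End Flip.

Section SmoothMaps.
Variables (R : realType) (m n : nat) (Y : manifold R m) (X : manifold R n).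

Record smooth_map := SmoothMap {
  smooth_map_fun :> Y -> X;
  smooth_map_continuous : continuous smooth_map_fun;
  smooth_map_smooth : forall b a j,
    csmooth_via (atlas Y b) (smooth_map_fun @^-1` chart_dom (atlas X a))
      (coordinate (atlas X a) j \o smooth_map_fun) }.

Variable g : smooth_map.

Fact open_smooth_map_preimage a : open (g @^-1` chart_dom (atlas X a)).
Proof.
apply: open_comp; last exact: open_chart_dom.
by move=> q _; exact: smooth_map_continuous.
Qed.

Fact pullback_subproof (f : Cinf X) : is_smooth (f \o g : Y -> R[i]).
Proof.
move=> b; apply: csmooth_via_local => q _ _.
have [a agq] := atlas_cover (g q).
exists (g @^-1` chart_dom (atlas X a)) => //.
apply: (csmooth_via_comp (c := atlas X a) (W' := setT)) => //.
- exact: open_smooth_map_preimage.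
- by move=> j; exact: smooth_map_smooth.
- exact: CinfP.
Qed.

Definition pullback (f : Cinf X) : Cinf Y := mkCinf (pullback_subproof f).

Definition pullback_ract (k : (Cinf Y)^o) (f : Cinf X) : (Cinf Y)^o :=
  (k : Cinf Y) * pullback f.

Fact pullback_ractDl k l f :
  pullback_ract (k + l) f = pullback_ract k f + pullback_ract l f.
Proof. exact: mulrDl. Qed.

Fact pullback_ractDr k f f' :
  pullback_ract k (f + f') = pullback_ract k f + pullback_ract k f'.
Proof. by rewrite -[RHS]mulrDr; congr (_ * _); exact: Cinf_eqP. Qed.

Fact pullback_ract1 k : pullback_ract k 1 = k.
Proof. by rewrite -[RHS]mulr1; congr (_ * _); exact: Cinf_eqP. Qed.

Fact pullback_ractM k f f' :
  pullback_ract k (f * f') = pullback_ract (pullback_ract k f) f'.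
Proof. by rewrite -[RHS]mulrA; congr (_ * _); exact: Cinf_eqP. Qed.

Fact pullback_scaler_ract (h : Cinf Y) k f :
  h *: pullback_ract k f = pullback_ract (h *: k) f.
Proof. exact: mulrA. Qed.

(* C^oo(Y) as a left C^oo(Y)-module, with right action k <| f = k (f \o g).   *)
Definition pullback_bimodule : bimodule (Cinf Y) (Cinf X) :=
  @Bimodule (Cinf Y) (Cinf X) (Cinf Y)^o pullback_ract pullback_ractDl
    pullback_ractDr pullback_ract1 pullback_ractM pullback_scaler_ract.

(* The canonical isomorphism Omega1(Y) ~ Omega1(Y) (x) C^oo(Y).               *)
Definition into_tensor (eta : Omega1 Y) : tensor (Omega1 Y) pullback_bimodule :=
  tens eta ((1 : Cinf Y) : pullback_bimodule).

(* The exterior derivative d, with target Omega1(Y) (x) C^oo(Y).              *)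
Definition d_pullback (k : pullback_bimodule) :
    tensor (Omega1 Y) pullback_bimodule :=
  into_tensor (dform (k : Cinf Y)).

End SmoothMaps.

Arguments d_pullback {R m n Y X} g k.

Section OpenSubmanifold.
Variables (R : realType) (n : nat) (X : manifold R n).

Section Build.
Variables (U : set X) (oU : open U).

Let incl : set_type U -> X := fun p => \val p.

Let incl_cont : continuous incl.
Proof. exact: initial_continuous. Qed.

Let incl_inj : injective incl.
Proof. exact: val_inj. Qed.

Let incl_U p : U (incl p). Proof. exact/set_mem/valP. Qed.

Let incl_open W : open W -> open (incl @` W).
Proof.
move=> [V oV <-].
rewrite (_ : _ @` _ = V `&` U); first exact: openI.
apply/seteqP; split=> [_ [p Vp <-]|p [Vp Up]]; first by split.
by exists (SigSub (mem_set Up)).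
Qed.

Section RestrictChart.
Variable c : chart R n X.

Fact restrict_chart_dom : open (incl @^-1` chart_dom c).
Proof. by exists (chart_dom c) => //; exact: open_chart_dom. Qed.

Fact restrict_chart_inj p q : (incl @^-1` chart_dom c) p ->
  (incl @^-1` chart_dom c) q -> (c \o incl) p = (c \o incl) q -> p = q.
Proof. by move=> cp cq /(chart_inj cp cq)/incl_inj. Qed.

Fact restrict_chart_continuous p : (incl @^-1` chart_dom c) p ->
  {for p, continuous (c \o incl)}.
Proof.
move=> cp; apply: continuous_comp; first exact: incl_cont.
exact: chart_continuous.
Qed.

Fact restrict_chart_open W : open W -> W `<=` incl @^-1` chart_dom c ->
  open ((c \o incl) @` W).
Proof.
move=> oW Wc; rewrite -image_comp; apply: chart_open; first exact: incl_open.
by move=> _ [p Wp <-]; exact: Wc.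
Qed.

Definition restrict_chart : chart R n (set_type U) :=
  Chart restrict_chart_dom restrict_chart_inj restrict_chart_continuous
    restrict_chart_open.

Lemma csmooth_via_restrict W f : open W ->
  csmooth_via c W f -> csmooth_via restrict_chart (incl @^-1` W) (f \o incl).
Proof.
move=> oW sf; apply: (@csmooth_viaP _ _ _ _ _ _ (local_rep c f)).
- by exists W.
- by move=> p cp Wp; rewrite local_repE.
- apply: csmooth_sub sf => _ [p [cp Wp] <-].
  by exists (incl p).
Qed.

Lemma cpartial_restrict W f i p : open W -> W (incl p) ->
  chart_dom c (incl p) ->
  cpartial restrict_chart i (f \o incl) p = cpartial c i f (incl p).
Proof.
move=> oW Wp cp; rewrite /cpartial.
have oW' : open (incl @^-1` W) by exists W.
apply: (@cderiv_eq _ _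
  (restrict_chart @` (chart_dom restrict_chart `&` (incl @^-1` W)))).
- exact: open_chart_image.
- by exists p.
- move=> _ [q [cq Wq] <-]; rewrite local_repE//.
  by rewrite -[LHS]/(f (incl q)) -(local_repE f cq).
Qed.

End RestrictChart.

Fact submanifold_hausdorff : hausdorff_space (set_type U).
Proof.
have := @manifold_hausdorff _ _ X; rewrite !open_hausdorff => hX p q pq.
have /hX [[A B] /= [pA qB] [oA oB AB]] : incl p != incl q.
  by apply: contra_neq pq; exact: incl_inj.
exists (incl @^-1` A, incl @^-1` B) => /=.
  by move: pA qB; rewrite !inE.
split; [by exists A|by exists B|].
rewrite -preimage_setI; move/eqP: AB => ->.
by rewrite preimage_set0.
Qed.

Fact submanifold_second_countable : @second_countable (set_type U).
Proof.
have [B cB [oB bB]] := @manifold_second_countable _ _ X.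
exists ((fun V => incl @^-1` V) @` B).
  by apply: sub_countable cB; exact: card_image_le.
split=> [_ [V BV <-]|p]; first by exists V => //; exact: oB.
move=> N [_ [[V oV <-] /= Vp VN]].
have nV : nbhs (incl p) V by apply: open_nbhs_nbhs; split.
have [V' [BV' V'p] V'V] := bB (incl p) V nV.
exists (incl @^-1` V'); first by split=> //; exists V'.
by apply: subset_trans VN => q /V'V.
Qed.

Fact submanifold_cover p :
  exists a, chart_dom (restrict_chart (atlas X a)) p.
Proof. exact: (atlas_cover (incl p)). Qed.

Fact submanifold_compatible a b : chart_compatible
  (restrict_chart (atlas X a)) (restrict_chart (atlas X b)).
Proof.
move=> j; exact: (@csmooth_via_restrict _ _ (coordinate (atlas X b) j)
  (@open_chart_dom _ _ _ (atlas X b)) (atlas_compatible a b j)).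
Qed.

Definition open_submanifold : manifold R n :=
  Manifold submanifold_hausdorff submanifold_second_countable
    submanifold_cover submanifold_compatible.

Fact inclusion_smooth (b a : atlas_index X) j :
  csmooth_via (restrict_chart (atlas X b)) (incl @^-1` chart_dom (atlas X a))
    (coordinate (atlas X a) j \o incl).
Proof.
exact: (@csmooth_via_restrict _ _ (coordinate (atlas X a) j)
  (@open_chart_dom _ _ _ (atlas X a)) (atlas_compatible b a j)).
Qed.

Definition inclusion : smooth_map open_submanifold X :=
  @SmoothMap _ _ _ open_submanifold X incl incl_cont inclusion_smooth.

Definition restrict_Cinf (f : Cinf X) : Cinf open_submanifold :=
  pullback inclusion f.

Fact restrict_form_subproof (om : form X) :
  is_form (X := open_submanifold) (fun a p => om a (incl p)).
Proof.
have [u1 u2 u3] := formP om; split.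
- by move=> a p; exact: u1.
- by move=> a i; exact: (csmooth_via_restrict openT (u2 a i)).
- move=> a b p i ap bp; rewrite (u3 a b)//; apply: eq_bigr => j _.
  congr (_ * _).
  by rewrite -(cpartial_restrict _ _ openT)//.
Qed.

Definition restrict_form (om : Omega1 X) : Omega1 open_submanifold :=
  mkform (restrict_form_subproof om).

Definition restrict_form2 : tensor (Omega1 X) (Omega1 X) ->
    tensor (Omega1 open_submanifold) (Omega1 open_submanifold) :=
  tensor_lift (fun xi eta => tens (restrict_form xi) (restrict_form eta)).

Definition connection_restricts
    (nabla : Omega1 X -> tensor (Omega1 X) (Omega1 X))
    (nablaU : Omega1 open_submanifold ->
      tensor (Omega1 open_submanifold) (Omega1 open_submanifold)) :=
  forall xi, nablaU (restrict_form xi) = restrict_form2 (nabla xi).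

End Build.

End OpenSubmanifold.

Lemma set_type_valP (T : Type) (U : set T) (p : set_type U) : U (\val p).
Proof. exact/set_mem/valP. Qed.

Section ChartManifold.
Variables (R : realType) (n : nat) (X : manifold R n) (a : atlas_index X).

Definition chart_manifold : manifold R n :=
  open_submanifold (open_chart_dom (atlas X a)).

Fact chart_coord_subproof i :
  is_smooth (X := chart_manifold) (fun p => coordinate (atlas X a) i (\val p)).
Proof.
move=> b; have sb := @csmooth_via_restrict _ _ _ _
  (open_chart_dom (atlas X a)) (atlas X b) _ (coordinate (atlas X a) i)
  (open_chart_dom (atlas X a)) (@atlas_compatible _ _ X b a i).
by apply: csmooth_via_sub sb => p _; exact: set_type_valP.
Qed.

Definition chart_coord i : Cinf chart_manifold := mkCinf (chart_coord_subproof i).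

Fact chart_partial_subproof i (f : Cinf chart_manifold) :
  is_smooth (X := chart_manifold) (cpartial (atlas chart_manifold a) i f).
Proof.
move=> b; apply: (@csmooth_via_atlas _ _ chart_manifold a b).
- exact: openT.
- by move=> p _; exact: set_type_valP.
- by apply: csmooth_cpartial openT _; exact: CinfP.
Qed.

Definition chart_partial i (f : Cinf chart_manifold) : Cinf chart_manifold :=
  mkCinf (chart_partial_subproof i f).

(* nabla(dx^i) = - Gamma^i_{jk} dx^j (x) dx^k                                 *)
Definition has_christoffel
    (nabla : Omega1 chart_manifold ->
      tensor (Omega1 chart_manifold) (Omega1 chart_manifold))
    (Gamma : 'I_n -> 'I_n -> 'I_n -> Cinf chart_manifold) :=
  forall i, nabla (dform (chart_coord i)) =
    - \sum_j \sum_k Gamma i j k *: tens (dform (chart_coord j)) (dform (chart_coord k)).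

End ChartManifold.

Section RestrictSmoothMap.
Variables (R : realType) (m n : nat) (Y : manifold R m) (X : manifold R n).
Variables (g : smooth_map Y X) (U : set X) (V : set Y).
Variables (oU : open U) (oV : open V) (gVU : forall q, V q -> U (g q)).

Definition restrict_map_fun (q : set_type V) : set_type U :=
  SigSub (mem_set (gVU (set_type_valP q))).

Fact restrict_map_continuous : continuous restrict_map_fun.
Proof.
apply: continuous_comp_initial => q.
rewrite -[_ \o _]/(g \o (fun q : set_type V => \val q)).
apply: continuous_comp; first exact: initial_continuous.
exact: smooth_map_continuous.
Qed.

Fact restrict_map_smooth (b : atlas_index Y) (a : atlas_index X) j :
  csmooth_via (restrict_chart oV (atlas Y b))
    (restrict_map_fun @^-1` chart_dom (restrict_chart oU (atlas X a)))
    (coordinate (restrict_chart oU (atlas X a)) j \o restrict_map_fun).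
Proof.
exact: (@csmooth_via_restrict _ _ _ _ oV _ _
  (coordinate (atlas X a) j \o g)
  (open_smooth_map_preimage g a) (smooth_map_smooth g b a j)).
Qed.

Definition restrict_map :
    smooth_map (open_submanifold oV) (open_submanifold oU) :=
  @SmoothMap _ _ _ (open_submanifold oV) (open_submanifold oU)
    restrict_map_fun restrict_map_continuous restrict_map_smooth.

(* sigmaVU : M_VU (x) Omega1(U) -> Omega1(V) (x) M_VU restricts sigma.         *)
Definition restrict_pullback_tensor :
    tensor (Omega1 Y) (pullback_bimodule g) ->
    tensor (Omega1 (open_submanifold oV)) (pullback_bimodule restrict_map) :=
  tensor_lift (fun eta (k : pullback_bimodule g) =>
    tens (restrict_form oV eta)
      (restrict_Cinf oV k : pullback_bimodule restrict_map)).

Definition sigma_restricts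
    (sigma : tensor (pullback_bimodule g) (Omega1 X) ->
      tensor (Omega1 Y) (pullback_bimodule g))
    (sigmaVU : tensor (pullback_bimodule restrict_map)
        (Omega1 (open_submanifold oU)) ->
      tensor (Omega1 (open_submanifold oV)) (pullback_bimodule restrict_map)) :=
  forall (k : Cinf Y) (xi : Omega1 X),
    sigmaVU (tens (restrict_Cinf oV k : pullback_bimodule restrict_map)
                  (restrict_form oU xi)) =
    restrict_pullback_tensor (sigma (tens (k : pullback_bimodule g) xi)).

End RestrictSmoothMap.

(* D(sigma) for the connections d on C^oo(Y) and nablaX, nablaY on 1-forms.   *)
Definition sigma_defect (R : realType) (m n : nat) (Y : manifold R m)
    (X : manifold R n) (g : smooth_map Y X)
    (nablaX : Omega1 X -> tensor (Omega1 X) (Omega1 X))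
    (nablaY : Omega1 Y -> tensor (Omega1 Y) (Omega1 Y))
    (sigma : bimodule_map (tensor (pullback_bimodule g) (Omega1 X))
                          (tensor (Omega1 Y) (pullback_bimodule g))) :
    tensor (pullback_bimodule g) (Omega1 X) ->
    tensor (Omega1 Y) (tensor (Omega1 Y) (pullback_bimodule g)) :=
  connection_defect
    (tensor_connection (d_pullback g) sigma nablaX)
    (tensor_connection nablaY (flip Y) (d_pullback g)) sigma.

(* Main.v *)
(* The map sigma is k (x) xi |-> k gamma^*(xi), where gamma^* is the pullback
   of 1-forms, well defined because the components of 1-forms and of
   differentials obey the same change-of-chart rule.  In charts,
     nabla(d gamma^i) = d(d_p gamma^i) (x) dy^p
                        - d_q gamma^i Xi^q_pr dy^p (x) dy^r
   carries the second derivatives as dy^r (x) dy^p, so reading off the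
   coefficient of dy^p (x) dy^r uses the symmetry of second derivatives; the
   Gamma term is the image under id (x) sigma of 1 (x) nabla(dx^i), whose
   coefficients cross the tensor product over C^oo(X) by the right action. *)
Require Import Defs.
From mathcomp Require Import all_boot all_order all_algebra.
From mathcomp Require Import complex ring.
From mathcomp Require Import all_classical all_reals all_analysis.

Set Implicit Arguments.
Unset Strict Implicit.
Unset Printing Implicit Defensive.

Import Order.TTheory GRing.Theory Num.Theory.
Import numFieldNormedType.Exports.

Local Open Scope classical_set_scope.
Local Open Scope ring_scope.

(** * Symmetry of mixed directional derivatives on a normed space *)

Section Schwarz.
Variables (R : realType) (V : normedModType R).
Implicit Types (f : V -> R) (x y u v w : V) (O : set V).

(** The two difference quotients coincide, since [(h + s) w = h w + s w]. This reduces directional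
    derivatives to one real variable, where the mean value theorem applies. *)
Lemma is_derive_line f y w (s : R) : derivable f (y + s *: w) w ->
  is_derive s 1 (fun t => f (y + t *: w)) ('D_w f (y + s *: w)).
Proof.
move=> df; have E :
    (fun h : R => h^-1 *: (((fun t => f (y + t *: w)) \o shift s) (h *: 1)
       - f (y + s *: w))) =
    (fun h => h^-1 *: ((f \o shift (y + s *: w)) (h *: w) - f (y + s *: w))).
  apply/funext => h /=; congr (_ *: (f _ - _)).
  by rewrite [h *: 1]mulr1 scalerDl addrCA addrA.
by split; rewrite /derivable /derive E.
Qed.

Lemma MVT_line f y w (h : R) : 0 < h ->
  (forall s, 0 <= s <= h -> derivable f (y + s *: w) w) ->
  exists2 s, 0 <= s <= h & f (y + h *: w) - f y = h * 'D_w f (y + s *: w).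
Proof.
move=> h0 df; pose g t := f (y + t *: w).
have dg s : 0 <= s <= h -> is_derive s 1 g ('D_w f (y + s *: w)).
  by move=> /df; exact: is_derive_line.
have [|/=|s sh E] := @MVT R g (fun s => 'D_w f (y + s *: w)) 0 h h0.
- by move=> s; rewrite in_itv/= => /andP[s0 sh]; apply: dg; rewrite !ltW.
- apply: derivable_within_continuous => s; rewrite in_itv/= => /dg.
  by case.
- exists s; first by move: sh; rewrite in_itv/= => /andP[? ?]; rewrite !ltW.
  by move: E; rewrite /g scale0r addr0 subr0 => ->; rewrite mulrC.
Qed.

(* The left-hand side is symmetric in u and v; this is what makes the mixed
   derivatives agree in the limit h -> 0. *)
Lemma second_difference f x u v (h : R) : 0 < h ->
  (forall s t, 0 <= s <= h -> 0 <= t <= h ->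
     derivable f (x + s *: u + t *: v) u /\
     derivable ('D_u f) (x + s *: u + t *: v) v) ->
  exists s t, [/\ 0 <= s <= h, 0 <= t <= h &
    f (x + h *: u + h *: v) - f (x + h *: u) - f (x + h *: v) + f x =
    h ^+ 2 * 'D_v ('D_u f) (x + s *: u + t *: v)].
Proof.
move=> h0 df; have h00 : 0 <= (0 : R) <= h by rewrite lexx ltW.
have hh : 0 <= h <= h by rewrite lexx ltW.
(* Differentiation commutes with the translation by [h *: v]. *)
have dfh s : 0 <= s <= h ->
    derivable (fun y => f (y + h *: v)) (x + s *: u) u /\
    'D_u (fun y => f (y + h *: v)) (x + s *: u) = 'D_u f (x + s *: u + h *: v).
  move=> sh; have [d1 _] := df s h sh hh; set z := x + s *: u in d1 *.
  have E : (fun k : R => k^-1 *: (((fun y => f (y + h *: v)) \o shift z) (k *: u)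
      - f (z + h *: v))) =
      (fun k => k^-1 *: ((f \o shift (z + h *: v)) (k *: u) - f (z + h *: v))).
    apply: funext => k /=; congr (_ *: (f _ - _)); exact: esym (addrA _ _ _).
  by rewrite /derivable /derive E; split; [exact: d1|].
have df0 s : 0 <= s <= h -> derivable f (x + s *: u) u.
  by move=> sh; have [] := df s 0 sh h00; rewrite scale0r addr0.
(* Mean value theorem twice: along [u] for the increment of [f] in direction [v], then along [v] for
   ['D_u f]. *)
have [|s sh E] := @MVT_line (fun y => f (y + h *: v) - f y) x u h h0.
  by move=> s sh; apply: derivableB; [have [] := dfh s sh|exact: df0].
have [|t th E'] := @MVT_line ('D_u f) (x + s *: u) v h h0.
  by move=> t th; have [] := df s t sh th.
exists s, t; split => //.
have [dfh1 dfh2] := dfh s sh.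
move: E; rewrite deriveB//; last exact: df0.
rewrite dfh2 E' => E; rewrite expr2 -mulrA -E.
by ring.
Qed.

(** Dividing the same second difference by [h ^+ 2] gives each mixed derivative at some point near
    [x]. By continuity each value is within [e / 2] of the one at [x], so the two limits differ by
    at most [e]. *)
Lemma derive_sym f x u v O : open O -> O x ->
  (forall y, O y -> [/\ derivable f y u, derivable f y v,
     derivable ('D_u f) y v & derivable ('D_v f) y u]) ->
  {for x, continuous ('D_v ('D_u f))} -> {for x, continuous ('D_u ('D_v f))} ->
  'D_v ('D_u f) x = 'D_u ('D_v f) x.
Proof.
move=> oO Ox df cuv cvu; apply/eqP; rewrite -subr_eq0 -normr_eq0.
apply/eqP/le_anti; rewrite normr_ge0 andbT; apply/ler_addgt0Pr => e e0.
rewrite add0r.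
have e2 : 0 < e / 2 by rewrite divr_gt0.
have nO : nbhs x O by exact: open_nbhs_nbhs.
have /pseudometric_normed_Zmodule.cvgrPdist_lt/(_ _ e2) nuv := cuv.
have /pseudometric_normed_Zmodule.cvgrPdist_lt/(_ _ e2) nvu := cvu.
have nI : nbhs x (O `&`
    ((fun y => `|'D_v ('D_u f) x - 'D_v ('D_u f) y| < e / 2) `&`
     (fun y => `|'D_u ('D_v f) x - 'D_u ('D_v f) y| < e / 2))).
  by apply: (filterI nO); apply: (filterI nuv); exact: nvu.
have [d /= d0 dO] := (nbhs_ballP _ _).1 nI.
(* The summand 1 keeps the denominator positive when [u] and [v] vanish and makes
   [h * (|u| + |v|) < d] strict. *)
pose h := d / (`|u| + `|v| + 1).
have k0 : 0 < `|u| + `|v| + 1 by rewrite ltr_wpDl// addr_ge0.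
have h0 : 0 < h by rewrite divr_gt0.
have near s t : 0 <= s <= h -> 0 <= t <= h -> ball x d (x + s *: u + t *: v).
  move=> /andP[s0 sh] /andP[t0 th]; rewrite -ball_normE /= -addrA opprD addNKr.
  rewrite normrN (le_lt_trans (ler_normD _ _))// !normrZ !ger0_norm//.
  rewrite (@le_lt_trans _ _ (h * `|u| + h * `|v|)) ?lerD ?ler_wpM2r//.
  by rewrite -mulrDr /h mulrAC ltr_pdivrMr// ltr_pM2l// ltrDl.
have [|s [t [sh th E]]] := @second_difference f x u v h h0.
  move=> s t sh th; have [Oy _] := dO _ (near s t sh th).
  by have [du _ duv _] := df _ Oy; split; [exact: du|exact: duv].
have [|t' [s' [t'h s'h E']]] := @second_difference f x v u h h0.
  move=> t' s' t'h s'h; rewrite addrAC.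
  have [Oy _] := dO _ (near s' t' s'h t'h).
  by have [_ dv _ dvu] := df _ Oy; split; [exact: dv|exact: dvu].
have [_ [/= b1 _]] := dO _ (near s t sh th).
have [_ [_ /= b2]] := dO _ (near s' t' s'h t'h).
have h2 : h ^+ 2 != 0 by rewrite expf_neq0// lt0r_neq0.
(* Up to the order of its terms the second difference is the same for [(u, v)] and [(v, u)];
   cancelling [h ^+ 2] equates the mixed derivatives at the two intermediate points. *)
move: E'; rewrite (addrAC x) -[_ - _ - _]addrAC E => /(mulfI h2) E'.
rewrite addrAC -E' distrC in b2.
rewrite (splitr e); apply: ltW; apply: le_lt_trans (ltrD b1 b2).
exact: ler_distD.
Qed.

End Schwarz.

(** * Symmetry of chart derivatives, and the differential in coordinates *)

Section SmoothSchwarz.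
Variables (R : realType) (n : nat).

Lemma smooth_derive_sym (O : set 'rV[R]_n) (f : 'rV[R]_n -> R) i j x :
  open O -> O x -> smooth_on O f ->
  'D_(delta_mx 0 j) ('D_(delta_mx 0 i) f) x =
  'D_(delta_mx 0 i) ('D_(delta_mx 0 j) f) x.
Proof.
(* Order 3 makes the second partial derivatives differentiable, hence continuous at [x]. *)
move=> oO Ox sf; have [df0 df1] := sf 3.
have df y k : O y -> derivable f y (delta_mx 0 k).
  by move=> Oy; apply: diff_derivable; exact: df0.
have ddf y k l : O y -> derivable ('D_(delta_mx 0 k) f) y (delta_mx 0 l).
  by move=> Oy; apply: diff_derivable; have [+ _] := df1 k; apply.
have cddf k l :
    {for x, continuous ('D_(delta_mx 0 l) ('D_(delta_mx 0 k) f))}.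
  apply: differentiable_continuous.
  by have [_ /(_ l)[+ _]] := df1 k; apply.
apply: (derive_sym oO Ox) => [y Oy||]; [|exact: cddf|exact: cddf].
by split; [exact: df|exact: df|exact: ddf|exact: ddf].
Qed.

Lemma cderiv_sym (O : set 'rV[R]_n) (f : 'rV[R]_n -> R[i]) i j x :
  open O -> O x -> csmooth_on O f ->
  cderiv j (cderiv i f) x = cderiv i (cderiv j f) x.
Proof.
by move=> oO Ox [fr fi]; apply: complexP;
  [exact: smooth_derive_sym oO Ox fr|exact: smooth_derive_sym oO Ox fi].
Qed.

Lemma cpartial_sym (T : topologicalType) (c : chart R n T) W i j f p :
  open W -> W p -> chart_dom c p -> csmooth_via c W f ->
  cpartial c j (cpartial c i f) p = cpartial c i (cpartial c j f) p.
Proof.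
move=> oW Wp cp sf; have oc := @open_chart_image _ _ _ c _ oW.
have cWp : (c @` (chart_dom c `&` W)) (c p) by exists p.
(* The local representative of a chart derivative is known only on the image of the chart; this
   image is open, so the outer derivative sees nothing else. *)
have E k l : cpartial c l (cpartial c k f) p =
    cderiv l (cderiv k (local_rep c f)) (c p).
  by apply: (cderiv_eq _ oc cWp) => _ [q [cq Wq] <-]; rewrite local_repE.
by rewrite !E; exact: cderiv_sym oc cWp sf.
Qed.

Lemma chart_partial_sym (X : manifold R n) (a : atlas_index X) i j
    (f : Cinf (chart_manifold a)) :
  chart_partial j (chart_partial i f) = chart_partial i (chart_partial j f).
Proof.
apply: Cinf_eqP => p; apply: (cpartial_sym _ _ openT) => //.
  exact: set_type_valP.
exact: (CinfP f a).
Qed.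

Lemma csmooth_via_sum (T : topologicalType) (c : chart R n T) W k
    (f : 'I_k -> T -> R[i]) : open W -> (forall j, csmooth_via c W (f j)) ->
  csmooth_via c W (fun p => \sum_j f j p).
Proof.
move=> oW sf; rewrite (_ : (fun p => _) = \sum_j f j); last first.
  by apply/funext => p; rewrite fct_sumE.
elim/big_ind: _ => [|g h sg sh|j _]; last exact: sf.
- exact: csmooth_via_cst.
- exact: csmooth_viaD.
Qed.

(** The chart [a] is defined on all of [chart_manifold a], so in any chart [b] this is the chain
    rule for the transition from [b] to [a]. *)
Lemma dform_coordE (X : manifold R n) (a : atlas_index X)
    (f : Cinf (chart_manifold a)) :
  dform f = \sum_i chart_partial i f *: dform (chart_coord a i).
Proof.
apply: form_ext => b p i bp; rewrite dformE//.
have ap : chart_dom (atlas (chart_manifold a) a) p by exact: set_type_valP.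
rewrite (cpartial_atlas _ (CinfP f) bp ap).
have -> (F : 'I_n -> Omega1 (chart_manifold a)) :
    (\sum_j F j : Defs.form _) b p 0 i = \sum_j (F j : Defs.form _) b p 0 i.
  elim/big_rec2: _ => [|k y1 y2 _ <-]; first by rewrite mxE.
  by rewrite -[LHS]/(((F k : Defs.form _) b p +
    (y2 : Defs.form _) b p) 0 i) mxE.
apply: eq_bigr => j _.
by rewrite -[RHS]/((chart_partial j f p *:
  (dform (chart_coord a j) : Defs.form _) b p) 0 i) mxE dformE.
Qed.

End SmoothSchwarz.

(** * Pullback of 1-forms along a smooth map *)

Section PullbackForm.
Variables (R : realType) (m n : nat) (Y : manifold R m) (X : manifold R n).
Variable g : smooth_map Y X.
Implicit Types (xi : Defs.form X) (a : atlas_index X) (b : atlas_index Y).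

(** An arbitrary choice of chart; [component_chart] shows that the pullback does not depend on
    it. *)
Definition chart_at (p : X) : atlas_index X := projT1 (cid (atlas_cover p)).

Lemma chart_atP p : chart_dom (atlas X (chart_at p)) p.
Proof. exact: (projT2 (cid (atlas_cover p))). Qed.

Let component xi a b q i := \sum_j xi a (g q) 0 j *
  cpartial (atlas Y b) i (coordinate (atlas X a) j \o g) q.

(** The Jacobian in the transformation rule of [xi] is the one that the chain rule produces for the
    coordinates of [a'] along [g]. *)
Let component_chart xi a a' b q i : chart_dom (atlas Y b) q ->
  chart_dom (atlas X a) (g q) -> chart_dom (atlas X a') (g q) ->
  component xi a b q i = component xi a' b q i.
Proof.
move=> bq aq a'q; rewrite /component.
under eq_bigr => j _ do
  rewrite (form_transform (formP xi) j aq a'q) mulr_suml.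
rewrite exchange_big; apply: eq_bigr => k _.
rewrite (@cpartial_comp _ _ _ _ _ (atlas Y b) (atlas X a) g
  (g @^-1` chart_dom (atlas X a) `&` g @^-1` chart_dom (atlas X a'))
  (chart_dom (atlas X a'))) //.
- by rewrite mulr_sumr; apply: eq_bigr => j _; rewrite mulrA.
- by apply: openI; exact: open_smooth_map_preimage.
- move=> j; apply: csmooth_via_sub (smooth_map_smooth g b a j).
  exact: subIsetl.
- exact: atlas_compatible.
Qed.

Fact pullback_form_subproof xi : is_form (fun b q =>
  if `[< chart_dom (atlas Y b) q >]
  then \row_i component xi (chart_at (g q)) b q i else 0).
Proof.
split=> [b q /asboolPn/negbTE -> //|b i|b b' q i bq b'q].
(* The chosen chart [chart_at (g r)] varies with [r]; near [q] it is replaced by the fixed chart [a]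
   around [g q]. *)
- apply: csmooth_via_local => q bq _.
  pose a := chart_at (g q); pose W := g @^-1` chart_dom (atlas X a).
  have oW : open W by exact: open_smooth_map_preimage.
  exists W; first exact: chart_atP.
  apply: (@csmooth_via_eq _ _ _ _ _ (fun r => component xi a b r i)) => //.
    move=> r br Wr; rewrite asboolT// mxE.
    by apply: component_chart => //; exact: chart_atP.
  apply: csmooth_via_sum => // j; apply: csmooth_viaM => //.
    apply: (@csmooth_via_comp _ _ _ _ _ (atlas Y b) (atlas X a) g W setT oW _ _
      (fun p => xi a p 0 j)) => //.
      by move=> k; exact: smooth_map_smooth.
    exact: form_smooth (formP xi) a j.
  by apply: csmooth_cpartial => //; exact: smooth_map_smooth.
- rewrite !asboolT// mxE /component.
  under [RHS]eq_bigr => k _ do rewrite mxE mulr_suml.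
  rewrite [RHS]exchange_big; apply: eq_bigr => j _.
  set a := chart_at (g q).
  have oW : open (g @^-1` chart_dom (atlas X a)).
    exact: open_smooth_map_preimage.
  (* Chain rule for the transition from [b] to [b'], with the chart of X kept fixed. *)
  have E : cpartial (atlas Y b) i (coordinate (atlas X a) j \o g) q =
      \sum_k cpartial (atlas Y b') k (coordinate (atlas X a) j \o g) q *
        cpartial (atlas Y b) i (coordinate (atlas Y b') k) q.
    apply: (@cpartial_comp _ _ _ _ _ (atlas Y b) (atlas Y b') id
      (chart_dom (atlas Y b') `&` g @^-1` chart_dom (atlas X a))
      (g @^-1` chart_dom (atlas X a))) => //.
    * by apply: openI => //; exact: open_chart_dom.
    * by move=> k; apply: csmooth_via_sub (atlas_compatible b b' k) => r [].
    * exact: smooth_map_smooth.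
    * by split => //; exact: chart_atP.
  by rewrite E mulr_sumr; apply: eq_bigr => k _; rewrite mulrA.
Qed.

Definition pullback_form (xi : Omega1 X) : Omega1 Y :=
  mkform (pullback_form_subproof xi).

Lemma pullback_formE xi a b q i : chart_dom (atlas Y b) q ->
  chart_dom (atlas X a) (g q) ->
  (pullback_form xi : Defs.form Y) b q 0 i = \sum_j xi a (g q) 0 j *
    cpartial (atlas Y b) i (coordinate (atlas X a) j \o g) q.
Proof.
move=> bq aq; rewrite /pullback_form /= asboolT// mxE.
by apply: component_chart => //; exact: chart_atP.
Qed.

Lemma pullback_formD : {morph pullback_form : xi eta / xi + eta}.
Proof.
move=> xi eta; apply: form_ext => b q i bq.
rewrite -[RHS]/(((pullback_form xi : Defs.form Y) b q +
  (pullback_form eta : Defs.form Y) b q) 0 i) mxE.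
rewrite !(pullback_formE _ _ bq (chart_atP (g q))) -big_split.
apply: eq_bigr => j _; rewrite [RHS]/= -mulrDl; congr (_ * _).
by rewrite -[in LHS]/((xi : Defs.form X) _ _ + (eta : Defs.form X) _ _) mxE.
Qed.

Lemma pullback_formZ f xi :
  pullback_form (f *: xi) = pullback g f *: pullback_form xi.
Proof.
apply: form_ext => b q i bq.
rewrite -[RHS]/((pullback g f q *:
  (pullback_form xi : Defs.form Y) b q) 0 i) mxE.
rewrite !(pullback_formE _ _ bq (chart_atP (g q))) mulr_sumr.
apply: eq_bigr => j _; rewrite mulrA; congr (_ * _).
by rewrite -[in LHS]/(f (g q) *: (xi : Defs.form X) _ _) mxE.
Qed.

(** The chain rule in a chart around [g q]. It turns [k (x) df] into [k d(f o g)] under sigma. *)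
Lemma pullback_form_dform f : pullback_form (dform f) = dform (pullback g f).
Proof.
apply: form_ext => b q i bq; pose a := chart_at (g q).
have aq : chart_dom (atlas X a) (g q) by exact: chart_atP.
rewrite (pullback_formE _ _ bq aq) dformE//.
rewrite (@cpartial_comp _ _ _ _ _ (atlas Y b) (atlas X a) g
  (g @^-1` chart_dom (atlas X a)) setT) //.
- by apply: eq_bigr => j _; rewrite dformE.
- exact: open_smooth_map_preimage.
- by move=> j; exact: smooth_map_smooth.
- exact: CinfP.
Qed.

End PullbackForm.

(** * Additive maps and finite sums of tensors *)

Lemma additive_sum (U V : zmodType) (f : U -> V) I (r : seq I) (F : I -> U) :
  {morph f : x y / x + y} -> f (\sum_(i <- r) F i) = \sum_(i <- r) f (F i).
Proof. by move=> fD; exact: (big_morph f fD (additive0 fD)). Qed.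

Lemma additiveN (U V : zmodType) (f : U -> V) x :
  {morph f : x y / x + y} -> f (- x) = - f x.
Proof.
by move=> fD; apply: (addrI (f x)); rewrite -fD !subrr (additive0 fD).
Qed.

Section TensorSums.
Variables (C B A : pzRingType) (Q : bimodule C B) (M : bimodule B A).

Lemma tens0l (m : M) : tens (0 : Q) m = 0.
Proof. by apply: (addrI (tens (0 : Q) m)); rewrite -tensDl !addr0. Qed.

Lemma tens0r (q : Q) : tens q (0 : M) = 0.
Proof. by apply: (addrI (tens q (0 : M))); rewrite -tensDr !addr0. Qed.

Lemma tens_suml I (r : seq I) (F : I -> Q) (m : M) :
  tens (\sum_(i <- r) F i) m = \sum_(i <- r) tens (F i) m.
Proof.
exact: (additive_sum (f := fun q : Q => tens q m) _ _
  (fun q q' => tensDl q q' m)).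
Qed.

Lemma tens_sumr I (r : seq I) (q : Q) (F : I -> M) :
  tens q (\sum_(i <- r) F i) = \sum_(i <- r) tens q (F i).
Proof. exact: (additive_sum (f := fun m : M => tens q m) _ _ (tensDr q)). Qed.

End TensorSums.

(** * The map sigma and the bimodule connection d *)

Section PullbackConnection.
Variables (R : realType) (m n : nat) (Y : manifold R m) (X : manifold R n).
Variable g : smooth_map Y X.
Local Notation M := (pullback_bimodule g).

Lemma into_tensorD (eta theta : Omega1 Y) :
  into_tensor g (eta + theta) = into_tensor g eta + into_tensor g theta.
Proof. exact: tensDl. Qed.

Lemma into_tensorZ (h : Cinf Y) (eta : Omega1 Y) :
  into_tensor g (h *: eta) = h *: into_tensor g eta.
Proof. exact: tensZl. Qed.

(** Balancing moves [k] into the form factor, so computations in the tensor product reduce to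
    computations with 1-forms on Y. *)
Lemma tens_into_tensor (eta : Omega1 Y) (k : M) :
  tens eta k = into_tensor g ((k : Cinf Y) *: eta).
Proof.
rewrite /into_tensor -[_ *: eta]/(ract eta (k : Cinf Y)) tens_bal.
by congr tens; rewrite -[RHS]/((k : Cinf Y) * 1) mulr1.
Qed.

Lemma ract_into_tensor (eta : Omega1 Y) (f : Cinf X) :
  ract (into_tensor g eta) f = into_tensor g (pullback g f *: eta).
Proof.
rewrite -tensR tens_into_tensor; congr (into_tensor g (_ *: _)).
by rewrite -[LHS]/(1 * pullback g f) mul1r.
Qed.

(** Balancedness over functions on X holds because pulling back [f xi] produces the factor [f o g],
    which is how [f] acts on the right of [M]. *)
Fact sigma_balanced : balanced (fun (k : M) (xi : Omega1 X) =>
  into_tensor g ((k : Cinf Y) *: pullback_form g xi)).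
Proof.
split=> [k l xi|k xi eta|k f xi].
- by rewrite -into_tensorD -scalerDl.
- by rewrite pullback_formD scalerDr into_tensorD.
- by rewrite pullback_formZ scalerA.
Qed.

Definition sigma_fun : tensor M (Omega1 X) -> tensor (Omega1 Y) M :=
  tensor_lift (fun (k : M) xi =>
    into_tensor g ((k : Cinf Y) *: pullback_form g xi)).

Lemma sigma_funE (k : M) (xi : Omega1 X) :
  sigma_fun (tens k xi) = into_tensor g ((k : Cinf Y) *: pullback_form g xi).
Proof. exact: tensor_liftE sigma_balanced. Qed.

Fact sigma_funD x y : sigma_fun (x + y) = sigma_fun x + sigma_fun y.
Proof. exact: (tensor_liftD sigma_balanced). Qed.

Fact sigma_funZ (h : Cinf Y) x : sigma_fun (h *: x) = h *: sigma_fun x.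
Proof.
elim/tensor_spanP: x => [|k xi x ih].
  by rewrite scaler0 (additive0 sigma_funD) scaler0.
rewrite scalerDr !sigma_funD ih scalerDr; congr (_ + _).
by rewrite -tensZl !sigma_funE -into_tensorZ scalerA.
Qed.

Fact sigma_funR x (f : Cinf X) : sigma_fun (ract x f) = ract (sigma_fun x) f.
Proof.
elim/tensor_spanP: x => [|k xi x ih].
  by rewrite ract0l (additive0 sigma_funD) ract0l.
rewrite ractDl !sigma_funD ih ractDl; congr (_ + _).
rewrite -tensR !sigma_funE ract_into_tensor.
by rewrite -[ract xi f]/(f *: xi) pullback_formZ !scalerA mulrC.
Qed.

Definition pullback_sigma :
    bimodule_map (tensor M (Omega1 X)) (tensor (Omega1 Y) M) :=
  BimoduleMap sigma_funD sigma_funZ sigma_funR.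

Lemma pullback_sigmaE (k : M) (xi : Omega1 X) :
  pullback_sigma (tens k xi) =
  into_tensor g ((k : Cinf Y) *: pullback_form g xi).
Proof. exact: sigma_funE. Qed.

Lemma d_pullback_left_connection : is_left_connection dform (d_pullback g).
Proof.
split=> [k l|b k]; first by rewrite /d_pullback dformD into_tensorD.
rewrite /d_pullback tens_into_tensor -into_tensorZ -into_tensorD.
by rewrite -[(b *: k : M)]/((b : Cinf Y) * (k : Cinf Y)) dformM addrC.
Qed.

(** The right Leibniz rule is the product rule for [k (f o g)]: the term with [dk] is the right
    action, the other one is sigma. *)
Lemma pullback_sigma_connection :
  is_bimodule_connection dform dform (d_pullback g) pullback_sigma.
Proof.
split; first exact: d_pullback_left_connection.
move=> k f; rewrite pullback_sigmaE pullback_form_dform /d_pullback.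
by rewrite ract_into_tensor -into_tensorD addrC -dformM.
Qed.

Lemma dformM_ract (k : Cinf Y) (f : Cinf X) :
  dform (k * pullback g f) - ract (dform k) (pullback g f) =
  k *: dform (pullback g f).
Proof. by rewrite dformM -[ract _ _]/(_ *: _) addrK. Qed.

(** The product rule for [1 * 1] gives [d1 = d1 + d1]. In both tensor product connections this kills
    the term that differentiates the generator 1 of [M]. *)
Lemma dform1 : dform (1 : Cinf Y) = 0.
Proof.
have := dformM (1 : Cinf Y) 1; rewrite mulr1 scale1r => /eqP.
by rewrite -subr_eq0 opprD addNKr oppr_eq0 => /eqP.
Qed.

End PullbackConnection.

(** * Compatibility of sigma with restriction to open subsets *)

Section Restriction.
Variables (R : realType) (m n : nat) (Y : manifold R m) (X : manifold R n).
Variables (g : smooth_map Y X) (U : set X) (V : set Y).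
Variables (oU : open U) (oV : open V) (gVU : forall q, V q -> U (g q)).
Local Notation g' := (restrict_map oU oV gVU).

Lemma restrict_formD : {morph restrict_form oV : xi eta / xi + eta}.
Proof. by move=> xi eta; exact: form_eqP. Qed.

Lemma restrict_formZ (k : Cinf Y) xi :
  restrict_form oV (k *: xi) = restrict_Cinf oV k *: restrict_form oV xi.
Proof. exact: form_eqP. Qed.

Lemma restrict_pullback_tensorE (eta : Omega1 Y) (k : pullback_bimodule g) :
  restrict_pullback_tensor oU oV gVU (tens eta k) =
  tens (restrict_form oV eta)
    (restrict_Cinf oV k : pullback_bimodule g').
Proof.
apply: tensor_liftE; split=> [eta1 eta2 l|eta1 k1 k2|eta1 f l].
- by rewrite restrict_formD tensDl.
- by rewrite -tensDr; congr tens; exact: Cinf_eqP.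
- rewrite -[ract _ _]/(f *: eta1) restrict_formZ.
  rewrite !tens_into_tensor scalerA; congr (into_tensor _ (_ *: _)).
  by apply: Cinf_eqP => p; rewrite CinfME mulrC.
Qed.

(** One chart around [g q] computes both sides, and derivatives in a restricted chart are those in
    the original chart. *)
Lemma pullback_form_restrict (xi : Omega1 X) :
  pullback_form g' (restrict_form oU xi) =
  restrict_form oV (pullback_form g xi).
Proof.
apply: form_ext => b q i bq; pose a := chart_at (g (\val q)).
have aq : chart_dom (atlas X a) (g (\val q)) by exact: chart_atP.
rewrite (@pullback_formE _ _ _ _ _ g' _ a _ _ _ bq aq).
rewrite -[RHS]/((pullback_form g xi : Defs.form Y) b (\val q) 0 i).
rewrite (@pullback_formE _ _ _ _ _ g _ a _ _ _ bq aq).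
apply: eq_bigr => j _; congr (_ * _).
rewrite -(@cpartial_restrict _ _ _ _ oV _ (g @^-1` chart_dom (atlas X a)))//.
exact: open_smooth_map_preimage.
Qed.

Lemma pullback_sigma_restricts :
  sigma_restricts (pullback_sigma g) (pullback_sigma g').
Proof.
move=> k xi; rewrite !pullback_sigmaE restrict_pullback_tensorE.
rewrite restrict_formZ pullback_form_restrict /into_tensor.
by congr tens; exact: Cinf_eqP.
Qed.

End Restriction.

(** * The coordinate formula for D(sigma) over a pair of charts *)

Section Defect.
Variables (R : realType) (m n : nat) (Y : manifold R m) (X : manifold R n).
Variables (a : atlas_index X) (b : atlas_index Y).
Local Notation U := (chart_manifold a).
Local Notation V := (chart_manifold b).
Variables (g : smooth_map V U).
Variables (nablaU : Omega1 U -> tensor (Omega1 U) (Omega1 U)).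
Variables (nablaV : Omega1 V -> tensor (Omega1 V) (Omega1 V)).
Variables (Gamma : 'I_n -> 'I_n -> 'I_n -> Cinf U).
Variables (Xi : 'I_m -> 'I_m -> 'I_m -> Cinf V).
Hypothesis cU : is_left_connection dform nablaU.
Hypothesis GammaU : has_christoffel nablaU Gamma.
Hypothesis cV : is_left_connection dform nablaV.
Hypothesis XiV : has_christoffel nablaV Xi.
Local Notation dx i := (dform (chart_coord a i)).
Local Notation dy p := (dform (chart_coord b p)).
Local Notation gam i := (pullback g (chart_coord a i)).
Local Notation one := ((1 : Cinf V) : pullback_bimodule g).

(** Expand [df] in the [dy q] and apply the Leibniz rule: differentiating the coefficients gives the
    Hessian, differentiating [dy q] gives the Christoffel term. *)
Lemma nabla_dform (f : Cinf V) : nablaV (dform f) =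
  \sum_p \sum_r (chart_partial r (chart_partial p f)
    - \sum_q chart_partial q f * Xi q p r) *: tens (dy p) (dy r).
Proof.
case: cV => VD VL; rewrite [in LHS]dform_coordE (additive_sum _ _ VD).
under eq_bigr => q _ do rewrite VL XiV dform_coordE tens_suml.
rewrite big_split /=.
under [RHS]eq_bigr => p _ do
  (under eq_bigr => r _ do rewrite scalerBl scaler_suml; rewrite big_split /=).
rewrite big_split /=; congr (_ + _).
  (* The outer derivative sits in the first tensor factor, so matching the stated order of
     derivatives takes their symmetry. *)
  rewrite exchange_big; apply: eq_bigr => p _; apply: eq_bigr => r _.
  by rewrite tensZl chart_partial_sym.
under eq_bigr => q _ do rewrite scalerN scaler_sumr.
rewrite sumrN exchange_big -sumrN; apply: eq_bigr => p _.
under eq_bigr => q _ do rewrite scaler_sumr.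
rewrite exchange_big -sumrN; apply: eq_bigr => r _.
by congr (- _); apply: eq_bigr => q _; rewrite scalerA.
Qed.

(** As [d1 = 0], the flip term vanishes on [df (x) 1] and only [nablaV (x) id] remains. *)
Lemma target_connection_dform (f : Cinf V) :
  tensor_connection nablaV (flip V) (d_pullback g) (into_tensor g (dform f)) =
  \sum_p \sum_r (chart_partial r (chart_partial p f)
    - \sum_q chart_partial q f * Xi q p r) *:
    tens (dy p) (into_tensor g (dy r)).
Proof.
rewrite (tensor_connectionE (flip_bimodule_connection cV)
  (d_pullback_left_connection g)).
rewrite /d_pullback dform1 [into_tensor g 0]tens0l tens0r.
rewrite (additive0 (@tensor_assocVD _ _ _ _ _ _ _)).
rewrite (additive0 (tensor_idD _)) (additive0 (@tensor_assocD _ _ _ _ _ _ _)).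
rewrite addr0 nabla_dform tens_suml.
rewrite (additive_sum _ _ (@tensor_assocD _ _ _ _ _ _ _)).
apply: eq_bigr => p _.
rewrite tens_suml (additive_sum _ _ (@tensor_assocD _ _ _ _ _ _ _)).
apply: eq_bigr => r _.
by rewrite -tensZl tensor_assocE tensZl.
Qed.

(** As [d1 = 0], what remains is [(id (x) sigma)(sigma (x) id)] applied to [1 (x) nablaU(dx i)]; it
    sends [f dx j (x) dx k] to [(f o g) d(gam j) (x) d(gam k)]. *)
Lemma source_connection_dx i :
  id_tensor (pullback_sigma g)
    (tensor_connection (d_pullback g) (pullback_sigma g) nablaU
      (tens one (dx i))) =
  - \sum_p \sum_r
      (\sum_j \sum_k pullback g (Gamma i j k) *
         chart_partial p (gam j) * chart_partial r (gam k)) *: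
      tens (dy p) (into_tensor g (dy r)).
Proof.
rewrite (tensor_connectionE (pullback_sigma_connection g) cU).
rewrite /d_pullback dform1 [into_tensor g 0]tens0l tens0l.
rewrite (additive0 (@tensor_assocD _ _ _ _ _ _ _)) add0r GammaU.
have sD : {morph pullback_sigma g : x y / x + y} by exact: bimodule_mapD.
(* The whole composite as one additive map, so that it can be evaluated term by term on the
   Christoffel expansion. *)
pose F (x : tensor (Omega1 U) (Omega1 U)) := id_tensor (pullback_sigma g)
  (tensor_assoc (tensor_id (pullback_sigma g) (tensor_assocV (tens one x)))).
have FD : {morph F : x y / x + y}.
  move=> x y; rewrite /F tensDr tensor_assocVD tensor_idD tensor_assocD.
  apply: tensor_liftD; split=> [q q' t|q t t'|q c t].
  - by rewrite tensDl.
  - by rewrite sD tensDr.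
  - by rewrite bimodule_mapZ tens_bal.
have FE (f : Cinf U) j k : F (f *: tens (dx j) (dx k)) =
    pullback g f *: tens (dform (gam j)) (into_tensor g (dform (gam k))).
  rewrite /F -tensZl tensor_assocVE tensor_idE pullback_sigmaE.
  rewrite /into_tensor tensor_assocE id_tensorE//; last exact: bimodule_mapZ.
  rewrite pullback_sigmaE pullback_formZ !pullback_form_dform !scale1r.
  by rewrite tensZl.
rewrite -[LHS]/(F _) (additiveN _ FD) (additive_sum _ _ FD); congr (- _).
under eq_bigr => j _ do rewrite (additive_sum _ _ FD).
under eq_bigr => j _ do under eq_bigr => k _ do rewrite FE.
have E j k : tens (dform (gam j)) (into_tensor g (dform (gam k))) =
    \sum_p \sum_r (chart_partial p (gam j) * chart_partial r (gam k)) *: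
      tens (dy p) (into_tensor g (dy r)).
  rewrite (dform_coordE (gam j)) tens_suml; apply: eq_bigr => p _.
  rewrite (dform_coordE (gam k)) /into_tensor tens_suml tens_sumr.
  apply: eq_bigr => r _; rewrite tensZl -[in RHS]scalerA; congr (_ *: _).
  (* The coefficient of [dy r] passes through the tensor sign to the first factor and then out of
     the tensor. *)
  by rewrite tensZl -tens_bal -tensZl.
under eq_bigr => j _ do under eq_bigr => k _ do rewrite E scaler_sumr.
(* With [(j, k)] merged into one index, the sums over [p] and [r] are moved outside one at a
   time. *)
rewrite pair_big /= exchange_big; apply: eq_bigr => p _ /=.
under eq_bigr => jk _ do rewrite scaler_sumr.
rewrite exchange_big; apply: eq_bigr => r _ /=.
rewrite pair_big scaler_suml; apply: eq_bigr => jk _.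
by rewrite scalerA mulrA.
Qed.

(** The minus sign in the Christoffel convention on X cancels the one in the definition of D(sigma),
    so the Gamma term enters with a plus. *)
Lemma pullback_sigma_defect i :
  sigma_defect nablaU nablaV (pullback_sigma g) (tens one (dx i)) =
  \sum_p \sum_r
    (chart_partial r (chart_partial p (gam i))
     - \sum_q chart_partial q (gam i) * Xi q p r
     + \sum_j \sum_k pullback g (Gamma i j k) *
         chart_partial p (gam j) * chart_partial r (gam k)) *:
    tens (dy p) (into_tensor g (dy r)).
Proof.
rewrite /sigma_defect /connection_defect source_connection_dx opprK.
rewrite pullback_sigmaE scale1r pullback_form_dform target_connection_dform.
rewrite -big_split; apply: eq_bigr => p _; rewrite -big_split.
by apply: eq_bigr => r _; rewrite [RHS]scalerDl.
Qed.

End Defect.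

Theorem proposition3p1 (R : realType) (n m : nat)
    (X : manifold R n) (Y : manifold R m) (gamma : smooth_map Y X)
    (nablaX : Omega1 X -> tensor (Omega1 X) (Omega1 X))
    (nablaY : Omega1 Y -> tensor (Omega1 Y) (Omega1 Y)) :
  is_left_connection dform nablaX ->
  is_left_connection dform nablaY ->
  exists sigma : bimodule_map (tensor (pullback_bimodule gamma) (Omega1 X))
                              (tensor (Omega1 Y) (pullback_bimodule gamma)),
  [/\ is_bimodule_connection dform dform (d_pullback gamma) sigma,
      forall (k : Cinf Y) (f : Cinf X),
        sigma (tens (k : pullback_bimodule gamma) (dform f)) =
        into_tensor gamma
          (dform (k * pullback gamma f) - ract (dform k) (pullback gamma f)),
      forall (k : Cinf Y) (f : Cinf X),
        dform (k * pullback gamma f) - ract (dform k) (pullback gamma f) =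
        k *: dform (pullback gamma f) &
      forall (a : atlas_index X) (b : atlas_index Y)
        (gammaVU : forall q,
          chart_dom (atlas Y b) q -> chart_dom (atlas X a) (gamma q)),
      let U := chart_manifold a in
      let V := chart_manifold b in
      let gamma' : smooth_map V U := restrict_map (open_chart_dom (atlas X a))
        (open_chart_dom (atlas Y b)) gammaVU in
      let dx i := dform (chart_coord a i) in
      let dy p := dform (chart_coord b p) in
      let gam i := pullback gamma' (chart_coord a i) in
      forall (nablaU : Omega1 U -> tensor (Omega1 U) (Omega1 U))
        (nablaV : Omega1 V -> tensor (Omega1 V) (Omega1 V))
        (Gamma : 'I_n -> 'I_n -> 'I_n -> Cinf U)
        (Xi : 'I_m -> 'I_m -> 'I_m -> Cinf V),
      is_left_connection dform nablaU -> connection_restricts nablaX nablaU ->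
      has_christoffel nablaU Gamma ->
      is_left_connection dform nablaV -> connection_restricts nablaY nablaV ->
      has_christoffel nablaV Xi ->
      exists sigma' : bimodule_map (tensor (pullback_bimodule gamma') (Omega1 U))
                              (tensor (Omega1 V) (pullback_bimodule gamma')),
      [/\ is_bimodule_connection dform dform (d_pullback gamma') sigma',
          sigma_restricts sigma sigma',
          forall (k : Cinf V) i,
            sigma' (tens (k : pullback_bimodule gamma') (dx i)) =
            into_tensor gamma' (k *: dform (gam i)) &
          forall i,
            sigma_defect nablaU nablaV sigma'
              (tens ((1 : Cinf V) : pullback_bimodule gamma') (dx i)) =
            \sum_p \sum_r
              (chart_partial r (chart_partial p (gam i))
               - \sum_q chart_partial q (gam i) * Xi q p r
               + \sum_j \sum_k pullback gamma' (Gamma i j k) *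
                   chart_partial p (gam j) * chart_partial r (gam k)) *:
              tens (dy p) (into_tensor gamma' (dy r))]].
Proof.
move=> _ _; exists (pullback_sigma gamma); split.
- exact: pullback_sigma_connection.
- move=> k f; rewrite dformM_ract pullback_sigmaE.
  by rewrite (pullback_form_dform gamma f).
- exact: dformM_ract.
move=> a b gammaVU U V g dx dy gam nablaU nablaV Gamma Xi cU _ GU cV _ XV.
(* Over charts the witness is the same construction for the restricted map; it restricts the global
   sigma because pullback of forms commutes with restriction. *)
exists (pullback_sigma g); split.
- exact: pullback_sigma_connection.
- exact: pullback_sigma_restricts.
- by move=> k i; rewrite pullback_sigmaE pullback_form_dform.
- exact: (pullback_sigma_defect g cU GU cV XV).
Qed.
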